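(* Let $E$ be the semigroup of order five given by the presentation (with zero $0$) \[E=\langle a,b,c\mid a^2=ab=0,\ ba=ca=a,\ b^2=bc=b,\ c^2=cb=c\rangle,\] let $E^1=E\cup\{1\}$ be the monoid obtained by adjoining an identity element, and let $\mathbb{E}^1$ be the monoid variety generated by $E^1$. Then $\mathbb{E}^1$ has exactly $\aleph_0$ (countably infinitely many) subvarieties. The lattice of subvarieties of $\mathbb{E}^1$ has width three, every subvariety of $\mathbb{E}^1$ is finitely based, and all except exactly two of the subvarieties of $\mathbb{E}^1$ are Cross.
   Context: Monoids are algebras in the signature $\{\cdot,1\}$; a monoid variety is a class of monoids defined by a set of identities, and the monoid variety generated by $M$ is the smallest monoid variety containing $M$. A variety is finitely based if it is defined by finitely many identities, finitely generated if it is generated by a finite algebra, and small if it has only finitely many subvarieties; it is Cross if it is finitely based, finitely generated and small. Subvarieties of a variety include the variety itself and the trivial variety, and are ordered by inclusion. The width of a lattice is the maximum size of an antichain in it. The elements of $E$ are $0,a,ac,b,c$. *)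

(* Defs.v *)
From HB Require Import structures.
From mathcomp Require Import all_boot monoid.

Set Implicit Arguments.
Unset Strict Implicit.
Unset Printing Implicit Defensive.

Local Open Scope group_scope.

(* Cardinality and width, stated for arbitrary types: the classes of monoids
   below live in a universe that is too large for the [finType] hierarchy or
   for sets in the sense of [classical_sets]. *)

Definition equipotent (A B : Type) : Prop := exists f : A -> B, bijective f.

Definition finite_type (A : Type) : Prop := exists n : nat, equipotent 'I_n A.

Definition has_antichain (T : Type) (le : T -> T -> Prop) (n : nat) : Prop :=
  exists x : 'I_n -> T, injective x /\ forall i j, le (x i) (x j) -> i = j.

Definition has_width (T : Type) (le : T -> T -> Prop) (n : nat) : Prop :=
  has_antichain le n /\ forall m, has_antichain le m -> m <= n.

(* By associativity and the unit laws, terms in the signature {*, 1} over the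
   variables x_0, x_1, ... may be taken to be words in the indices of the
   variables; the empty word is the term 1. *)

Definition word : Type := seq nat.

Definition identity : Type := (word * word)%type.

Definition eval_word (M : monoidType) (v : nat -> M) (w : word) : M :=
  \big[*%g/1]_(i <- w) v i.

Definition satisfies (M : monoidType) (e : identity) : Prop :=
  forall v : nat -> M, eval_word v e.1 = eval_word v e.2.

Definition monoid_class := monoidType -> Prop.

Definition class_incl (V W : monoid_class) : Prop := forall M, V M -> W M.

Definition defined_by (V : monoid_class) (Sigma : identity -> Prop) : Prop :=
  forall M, V M <-> forall e, Sigma e -> satisfies M e.

Definition monoid_variety (V : monoid_class) : Prop :=
  exists Sigma : identity -> Prop, defined_by V Sigma.

(* The intersection of all varieties containing M. *)
Definition variety_generated_by (M : monoidType) : monoid_class :=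
  fun N => forall V, monoid_variety V -> V M -> V N.

Definition subvariety (W V : monoid_class) : Prop :=
  monoid_variety V /\ class_incl V W.

Definition subvarieties (W : monoid_class) : Type :=
  {V : monoid_class | subvariety W V}.

Definition subvariety_le (W : monoid_class) (U V : subvarieties W) : Prop :=
  class_incl (sval U) (sval V).

Definition finitely_based (V : monoid_class) : Prop :=
  exists s : seq identity, defined_by V (fun e => e \in s).

Definition finitely_generated (V : monoid_class) : Prop :=
  exists M : monoidType, finite_type M /\ V = variety_generated_by M.

Definition small (V : monoid_class) : Prop := finite_type (subvarieties V).

Definition Cross (V : monoid_class) : Prop :=
  [/\ finitely_based V, finitely_generated V & small V].

(* The monoid S^1; [None] is the new identity element. *)

Definition adjoin_one (S : Type) : Type := option S.

Section AdjoinOne.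
Variable S : semigroupType.

Definition adjoin_mul (x y : adjoin_one S) : adjoin_one S :=
  match x, y with
  | None, _ => y
  | _, None => x
  | Some s, Some t => Some (s * t)
  end.

Lemma adjoin_mulA : associative adjoin_mul.
Proof. by case=> [x|] [y|] [z|] //=; rewrite mulgA. Qed.

Lemma adjoin_1mul : left_id None adjoin_mul.
Proof. by case. Qed.

Lemma adjoin_mul1 : right_id None adjoin_mul.
Proof. by case. Qed.

HB.instance Definition _ := Choice.on (adjoin_one S).
HB.instance Definition _ :=
  isMonoid.Build (adjoin_one S) adjoin_mulA adjoin_1mul adjoin_mul1.

End AdjoinOne.

(* The semigroup E, given by its multiplication table; [E_presentation] below
   shows that it is the semigroup with zero presented by
   < a, b, c | aa = ab = 0, ba = ca = a, bb = bc = b, cc = cb = c >. *)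

Variant E := E0 | Ea | Eac | Eb | Ec.

Definition E_to_nat (x : E) : nat :=
  match x with E0 => 0 | Ea => 1 | Eac => 2 | Eb => 3 | Ec => 4 end%N.

Definition E_of_nat (n : nat) : E := nth E0 [:: E0; Ea; Eac; Eb; Ec] n.

Lemma E_to_natK : cancel E_to_nat E_of_nat.
Proof. by case. Qed.

HB.instance Definition _ := Countable.copy E (can_type E_to_natK).

Definition E_mul (x y : E) : E :=
  match x, y with
  | E0, _ | _, E0 => E0
  | (Ea | Eac), (Ea | Eac) => E0
  | Ea, Eb => E0
  | Ea, Ec => Eac
  | Eac, (Eb | Ec) => Eac
  | (Eb | Ec), (Ea | Eac) => y
  | Eb, (Eb | Ec) => Eb
  | Ec, (Eb | Ec) => Ec
  end.

Lemma E_mulA : associative E_mul.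
Proof. by case; case; case. Qed.

HB.instance Definition _ := isSemigroup.Build E E_mulA.

Definition E_relations (S : semigroupType) (z a b c : S) : Prop :=
  [/\ forall x, z * x = z /\ x * z = z,
      a * a = z /\ a * b = z,
      b * a = a /\ c * a = a,
      b * b = b /\ b * c = b
    & c * c = c /\ c * b = c].

Definition E_morphism (S : semigroupType) (z a b c : S) (h : E -> S) : Prop :=
  {morph h : x y / x * y} /\ [/\ h E0 = z, h Ea = a, h Eb = b & h Ec = c].

Lemma E_presentation :
  E_relations E0 Ea Eb Ec /\
  forall (S : semigroupType) (z a b c : S), E_relations z a b c ->
    exists2 h, E_morphism z a b c h & forall g, E_morphism z a b c g -> g =1 h.
Proof.
split; first by split=> //; case.
move=> S z a b c [z0 [aa ab] [ba ca] [bb bc] [cc cb]].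
have z0l x : z * x = z by case: (z0 x).
have z0r x : x * z = z by case: (z0 x).
pose h x := match x with
  | E0 => z | Ea => a | Eac => a * c | Eb => b | Ec => c end.
have hM : {morph h : x y / x * y}.
  have aca : a * c * a = z by rewrite -mulgA ca.
  have acb : a * c * b = a * c by rewrite -mulgA cb.
  have acc : a * c * c = a * c by rewrite -mulgA cc.
  by case; case; rewrite /h /= ?mulgA ?z0l ?z0r ?aca ?aa ?ab ?ba ?ca ?bb ?bc
    ?cc ?cb ?acb ?acc ?z0l.
exists h => // g [gM [g0 ga gb gc]]; case=> //=.
by rewrite -ga -gc -gM.
Qed.

Definition E1 : monoidType := adjoin_one E.

(* Main.v *)
Require Import Defs.
From mathcomp Require Import all_boot monoid.
From Stdlib Require List.
From HB Require Import structures.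
From mathcomp Require Import boolp.

(** Let sq a = a a.  The monoids of the variety of E^1 are those satisfying
xyx = xxyx = xyxx and xxyyxx = xxyy: these identities turn a word into an
alternation of letters that occur only once and of blocks, that is, of products
of distinct squares.  In a proper subvariety an identity equates two words that
differ either in the content of a block or in the order of two squares in a
block.  Sending all other letters to 1, and the linear letters to 1 or to
arbitrary values, a difference in content yields one of xxt = xtx, txx = xtx,
xtsx = xtxsx, and allows blocks to be saturated until the contents agree; a
difference in order yields p xxyy = p yyxx, where p depends only on the number k
of alternations between x and y in the blocks to the left ([id_alt k]), or
xxyy t xxyy = xxyy t yyxx ([id_swap2]) if these two letters already share a block.
Conversely the same identities suffice to sort the blocks.  A subvariety is
therefore determined by which of these critical identities hold in it
([critical_transfer]), which leaves twelve varieties and the chain of those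
defined by [id_alt k].  The chain is strict by a transition monoid
([alt_monoid]); its only upper bounds are the two varieties defined by
[id_swap2] and by no further identity, and these are the two non-Cross ones. *)

Set Implicit Arguments.
Unset Strict Implicit.
Unset Printing Implicit Defensive.

(** * Words and critical identities *)

(** The members of a variety are never described. [critical_transfer] compares a class V with one
    monoid M: if M inherits the critical identities of V, it inherits all identities of V. It serves
    three times: for a subvariety and the members of its candidate, for a variety containing E^1 and
    any model of [basis], and for a relatively free monoid and the variety it should generate. In
    the second case the hypotheses are vacuous, since E^1 fails [id_swap2], the weakest critical
    identity. The order of two squares can be read off because of absorption: after xxyy, later
    squares of x and y have no effect once all other letters are 1. Hence at the first block where
    the two sides order x and y differently, the prefixes agree, the tails vanish, and only the way
    x and y alternate in the prefix matters. Finite generation rests on [id_alt l] getting weaker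
    with l: below a member of the chain, only critical identities in a bounded number of letters can
    fail. *)

Section EvalWord.
Local Open Scope group_scope.
Variable M : monoidType.
Implicit Types (v : nat -> M) (u w : word).

Lemma eval_nil v : eval_word v [::] = 1.
Proof. by rewrite /eval_word big_nil. Qed.

Lemma eval_cons v z w : eval_word v (z :: w) = v z * eval_word v w.
Proof. by rewrite /eval_word big_cons. Qed.

Lemma eval_cat v u w : eval_word v (u ++ w) = eval_word v u * eval_word v w.
Proof.
by elim: u => [|z u IH]; rewrite ?eval_nil ?mul1g //= !eval_cons IH mulgA.
Qed.

Lemma eval_seq1 v z : eval_word v [:: z] = v z.
Proof. by rewrite eval_cons eval_nil mulg1. Qed.

Lemma eq_in_eval v1 v2 w : {in w, v1 =1 v2} -> eval_word v1 w = eval_word v2 w.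
Proof. exact: eq_big_seq. Qed.

Lemma eval_one v w : {in w, forall z, v z = 1} -> eval_word v w = 1.
Proof.
elim: w => [|z w IH] h; first by rewrite eval_nil.
by rewrite eval_cons h ?mem_head // IH ?mulg1 // => y yw; apply: h;
  rewrite inE yw orbT.
Qed.

Definition subst (s : nat -> word) w : word := flatten (map s w).

Lemma eval_subst v s w : eval_word v (subst s w) = eval_word (fun i => eval_word v (s i)) w.
Proof.
by elim: w => [|z w IH]; rewrite ?eval_nil // /subst /= eval_cat -/(subst s w) IH eval_cons.
Qed.

End EvalWord.

Definition evalE := (eval_cat, eval_cons, eval_nil).

Definition models (s : seq identity) : monoid_class :=
  fun M => forall e, e \in s -> satisfies M e.

Definition holds_in (V : monoid_class) (e : identity) : Prop :=
  forall M, V M -> satisfies M e.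

Lemma models_cat s1 s2 M : models (s1 ++ s2) M <-> models s1 M /\ models s2 M.
Proof.
split=> [h|[h1 h2] e]; first by split=> e es; apply: h; rewrite mem_cat es ?orbT.
by rewrite mem_cat => /orP[/h1|/h2].
Qed.

Lemma models1 e M : models [:: e] M <-> satisfies M e.
Proof.
by split=> [h|h e']; [apply: h; rewrite mem_head|rewrite inE => /eqP->].
Qed.

Lemma models2 e1 e2 M :
  models [:: e1; e2] M <-> satisfies M e1 /\ satisfies M e2.
Proof. by rewrite -[[:: e1; e2]]/([:: e1] ++ [:: e2]) models_cat !models1. Qed.

Lemma variety_models s : monoid_variety (models s).
Proof. by exists (fun e => e \in s). Qed.

Lemma class_eqP (V W : monoid_class) : (forall M, V M <-> W M) -> V = W.
Proof. by move=> h; apply/funext => M; apply/propext. Qed.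

Lemma variety_theory V M : monoid_variety V ->
  (forall e, holds_in V e -> satisfies M e) -> V M.
Proof.
by move=> [S VS] h; apply/VS => e Se; apply: h => N /VS; apply.
Qed.

Definition id_triv : identity := ([:: 0], [::]).
Definition id_idem : identity := ([:: 0], [:: 0; 0]).
Definition id_comm : identity := ([:: 0; 1], [:: 1; 0]).
Definition id_left : identity := ([:: 0; 0; 1], [:: 0; 1; 0]).
Definition id_right : identity := ([:: 1; 0; 0], [:: 0; 1; 0]).
Definition id_mid : identity := ([:: 0; 1; 2; 0], [:: 0; 1; 0; 2; 0]).
Definition id_swap2 : identity :=
  ([:: 0; 0; 1; 1; 2; 0; 0; 1; 1], [:: 0; 0; 1; 1; 2; 1; 1; 0; 0]).

(** The rightmost square is always that of the letter 1; raising k adds a square on the left,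
    followed by a new linear letter. This makes [id_alt k] imply [id_alt k.+1]. *)
Fixpoint alt_word (k : nat) : word :=
  if k is k'.+1 then [:: odd k : nat, odd k : nat, k'.+2 & alt_word k'] else [::].

Definition id_alt (k : nat) : identity :=
  (alt_word k ++ [:: 0; 0; 1; 1], alt_word k ++ [:: 1; 1; 0; 0]).

Definition basis : seq identity :=
  [:: ([:: 0; 1; 0], [:: 0; 0; 1; 0]); ([:: 0; 1; 0], [:: 0; 1; 0; 0]);
      ([:: 0; 0; 1; 1; 0; 0], [:: 0; 0; 1; 1])].

Section Semantics.
Local Open Scope group_scope.
Variable M : monoidType.
Implicit Types a b c m t : M.

Let val a b c (i : nat) : M := nth 1 [:: a; b; c] i.

Lemma satisfies_triv : satisfies M id_triv <-> forall a, a = 1.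
Proof.
split=> [h a|h v]; last by rewrite [LHS]h [RHS]h.
by have := h (val a 1 1); rewrite /= !evalE ?mulg1.
Qed.

Lemma satisfies_idem : satisfies M id_idem <-> forall a, a * a = a.
Proof.
split=> [h a|h v]; last by rewrite /= !evalE ?mulg1.
by have := h (val a 1 1); rewrite /= !evalE ?mulg1.
Qed.

Lemma satisfies_comm : satisfies M id_comm <-> forall a b, a * b = b * a.
Proof.
split=> [h a b|h v]; last by rewrite /= !evalE ?mulg1.
by have := h (val a b 1); rewrite /= !evalE ?mulg1.
Qed.

Lemma satisfies_left : satisfies M id_left <-> forall a t, a * a * t = a * t * a.
Proof.
split=> [h a b|h v]; last by rewrite /= !evalE ?mulg1 !mulgA.
by have := h (val a b 1); rewrite /= !evalE ?mulg1 !mulgA.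
Qed.

Lemma satisfies_right : satisfies M id_right <-> forall a t, t * a * a = a * t * a.
Proof.
split=> [h a b|h v]; last by rewrite /= !evalE ?mulg1 !mulgA.
by have := h (val a b 1); rewrite /= !evalE ?mulg1 !mulgA.
Qed.

Lemma satisfies_mid :
  satisfies M id_mid <-> forall a t s, a * t * s * a = a * t * a * s * a.
Proof.
split=> [h a b c|h v]; last by rewrite /= !evalE ?mulg1 !mulgA.
by have := h (val a b c); rewrite /= !evalE ?mulg1 !mulgA.
Qed.

Lemma satisfies_basis : models basis M <->
  [/\ forall a t, a * t * a = a * a * t * a,
      forall a t, a * t * a = a * t * a * a &
      forall a b, a * a * b * b * a * a = a * a * b * b].
Proof.
split=> [h|[h1 h2 h3] e].
  split=> [a t|a t|a t].
  - have /h/(_ (val a t 1)) : ([:: 0; 1; 0], [:: 0; 0; 1; 0])%N \in basis by [].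
    by rewrite /= !evalE ?mulg1 !mulgA.
  - have /h/(_ (val a t 1)) : ([:: 0; 1; 0], [:: 0; 1; 0; 0])%N \in basis by [].
    by rewrite /= !evalE ?mulg1 !mulgA.
  - have /h/(_ (val a t 1)) :
      ([:: 0; 0; 1; 1; 0; 0], [:: 0; 0; 1; 1])%N \in basis by [].
    by rewrite /= !evalE ?mulg1 !mulgA.
rewrite !inE => /orP[/eqP->|/orP[/eqP->|/eqP->]] v;
  by rewrite /= !evalE ?mulg1 !mulgA.
Qed.

(** Locked, so that a square stays an atom when products are reassociated. *)
Definition sq a := locked (a * a).

Lemma sqE a : sq a = a * a.
Proof. by rewrite /sq -lock. Qed.

Lemma satisfies_swap2 : satisfies M id_swap2 <->
  forall a b c, sq a * sq b * c * sq a * sq b = sq a * sq b * c * sq b * sq a.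
Proof.
split=> [h a b c|h v]; last by move: (h (v 0) (v 1%N) (v 2));
  rewrite /= !evalE ?mulg1 !sqE !mulgA.
by have := h (val a b c); rewrite /= !evalE ?mulg1 !sqE !mulgA.
Qed.

(** Semantic form of [alt_word]: k squares, alternately of a and b, are scattered factors of m, and
    the rightmost of them is that of b. *)
Fixpoint alternates (a b : M) (k : nat) (m : M) : Prop :=
  if k is k'.+1 then
    exists q m', m = q * sq (if odd k then b else a) * m' /\ alternates a b k' m'
  else True.

Lemma alternates_mull a b k q m : alternates a b k m -> alternates a b k (q * m).
Proof.
by case: k => //= k [q' [m' [-> h]]]; exists (q * q'), m'; rewrite !mulgA.
Qed.

Lemma alternates_mulr a b k q m : alternates a b k m -> alternates a b k (m * q).
Proof.
elim: k m => //= k IH m [q' [m' [-> h]]].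
by exists q', (m' * q); split; [rewrite !mulgA|apply: IH].
Qed.

Lemma alternates_pred a b k m : alternates a b k.+1 m -> alternates a b k m.
Proof. by move=> [q [m' [-> h]]]; apply: alternates_mull. Qed.

Lemma alternates_word (v : nat -> M) k :
  alternates (v 0) (v 1%N) k (eval_word v (alt_word k)).
Proof.
elim: k => //= k IH; exists 1, (v k.+2 * eval_word v (alt_word k)).
rewrite !eval_cons mul1g !sqE -!mulgA; split; last exact: alternates_mull.
by case: (odd k).
Qed.

(** Converse of [alternates_word] up to a left factor, which is harmless because an equation may be
    multiplied by it. The function d records the values of the separators, so that one valuation
    fits all stages of the induction. *)
Lemma word_alternates a b k m : alternates a b k m ->
  exists q d, forall v : nat -> M, v 0 = a -> v 1%N = b ->
    (forall i, i < k -> v i.+2 = d i) -> m = q * eval_word v (alt_word k).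
Proof.
elim: k m => [m _|k IH m [q [m' [-> /IH [q' [d h]]]]]].
  by exists m, (fun=> 1) => v _ _ _; rewrite eval_nil mulg1.
exists q, (fun i => if i == k then q' else d i) => v v0 v1 vc.
rewrite (h v) // => [|i ik]; last by rewrite vc ?(ltnW ik) ?ltnS 1?ltnW // ltn_eqF.
rewrite /= !eval_cons (vc k) // eqxx !sqE !mulgA.
by case: (odd k); rewrite /= ?v0 ?v1.
Qed.

Lemma satisfies_alt k : satisfies M (id_alt k) <->
  forall a b m, alternates a b k m -> m * sq a * sq b = m * sq b * sq a.
Proof.
split=> [h a b m /word_alternates [q [d H]]|h v]; last first.
  rewrite /= !evalE ?mulg1; have := h _ _ _ (alternates_word v k).
  by rewrite !sqE !mulgA.
pose v i := if i is j.+2 then d j else if i == 0 then a else b.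
rewrite (H v) //; have := h v; rewrite /= !evalE ?mulg1 /v /= => E.
by rewrite !sqE !mulgA in E *; rewrite -!mulgA; congr (q * _); rewrite !mulgA.
Qed.

End Semantics.

(** * Calculus of squares *)

Section SquareCalculus.
Local Open Scope group_scope.
Variable M : monoidType.
Hypothesis hM : models basis M.
Implicit Types a b c m t s : M.

Lemma dup_first a t : a * t * a = sq a * t * a.
Proof. by case/satisfies_basis: hM => h _ _; rewrite sqE; exact: h. Qed.

Lemma dup_last a t : a * t * a = a * t * sq a.
Proof. by case/satisfies_basis: hM => _ h _; rewrite sqE mulgA. Qed.

Lemma sq_absorb a b : sq a * sq b * sq a = sq a * sq b.
Proof. by case/satisfies_basis: hM => _ _ h; rewrite !sqE !mulgA; exact: h. Qed.

Lemma sq_idem a : sq a * sq a = sq a.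
Proof.
(* The case t = 1 of [dup_first]. *)
have e : a * a = a * a * a by have := dup_first a 1; rewrite sqE !mulg1.
by rewrite !sqE mulgA -!e.
Qed.

Lemma mul_sq_idem m a : m * sq a * sq a = m * sq a.
Proof. by rewrite -mulgA sq_idem. Qed.

Lemma dup_ends a t : a * t * a = sq a * t * sq a.
Proof.
by rewrite dup_first {1}[sq a]sqE -(mulgA a a t) (dup_last a (a * t)) mulgA -sqE.
Qed.

(** The equation m * sq a = m expresses that m has already absorbed the square of a; this property
    survives multiplication by a further square. *)
Lemma absorb_mul_sq m a b : m * sq a = m -> m * sq b * sq a = m * sq b.
Proof. by move=> <-; rewrite -!mulgA (mulgA (sq a)) sq_absorb. Qed.

Lemma leftP : satisfies M id_left <-> forall a t, sq a * t * sq a = sq a * t.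
Proof.
rewrite satisfies_left; split=> h a t; first by rewrite -h sq_idem.
by rewrite -sqE (dup_ends a t) h.
Qed.

Lemma rightP : satisfies M id_right <-> forall a t, sq a * t * sq a = t * sq a.
Proof.
rewrite satisfies_right; split=> h a t; first by rewrite -h -mulgA sq_idem.
by rewrite (dup_ends a t) h sqE mulgA.
Qed.

Lemma midP : satisfies M id_mid <->
  forall a t s, sq a * t * sq a * s * sq a = sq a * t * s * sq a.
Proof.
rewrite satisfies_mid; split=> h a t s; first by rewrite h.
rewrite (dup_last a t).
have -> : a * t * s * a = a * (t * s) * a by rewrite !mulgA.
have -> : a * t * sq a * s * a = a * (t * sq a * s) * a by rewrite !mulgA.
by rewrite (dup_ends a (t * s)) (dup_ends a (t * sq a * s)) !mulgA h.
Qed.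

Lemma left_mid : satisfies M id_left -> satisfies M id_mid.
Proof. by move=> /leftP h; apply/midP => a t s; rewrite h. Qed.

Lemma right_mid : satisfies M id_right -> satisfies M id_mid.
Proof.
move=> /rightP h; apply/midP => a t s.
by rewrite -!mulgA (mulgA (sq a) s) h.
Qed.

Lemma idem_left : satisfies M id_idem -> satisfies M id_left.
Proof.
move=> /satisfies_idem h; apply/leftP => a t.
have hs (x : M) : sq x = x by rewrite sqE h.
by rewrite -(hs t) sq_absorb.
Qed.

Lemma comm_left : satisfies M id_comm -> satisfies M id_left.
Proof.
move=> /satisfies_comm h; apply/leftP => a t.
by rewrite (h (sq a * t)) mulgA sq_idem.
Qed.

Lemma comm_right : satisfies M id_comm -> satisfies M id_right.
Proof.
move=> /satisfies_comm h; apply/rightP => a t.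
by rewrite -mulgA (h (sq a)) -mulgA sq_idem.
Qed.

(** The product [sq a * sq b * sq a] equals [sq a * sq b] by absorption and [sq b * sq a] by
    [id_right]. *)
Lemma right_alt0 : satisfies M id_right -> satisfies M (id_alt 0).
Proof.
move=> /rightP h; apply/satisfies_alt => a b m _.
by rewrite -[LHS]mulgA -[RHS]mulgA -sq_absorb h.
Qed.

Lemma comm_alt0 : satisfies M id_comm -> satisfies M (id_alt 0).
Proof. by move=> /comm_right/right_alt0. Qed.

(** Since a square of b stands on the left, [id_mid] inserts another one in front of [sq a * sq b];
    the last square of b is then absorbed. *)
Lemma mid_alt1 : satisfies M id_mid -> satisfies M (id_alt 1).
Proof.
move=> /midP h; apply/satisfies_alt => a b _ [q [m [-> _]]] /=.
by rewrite -!mulgA; congr (q * _); rewrite !mulgA -h absorb_mul_sq // mul_sq_idem.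
Qed.

Lemma alt_succ k : satisfies M (id_alt k) -> satisfies M (id_alt k.+1).
Proof.
by move=> /satisfies_alt h; apply/satisfies_alt => a b m /alternates_pred/h.
Qed.

Lemma alt_leq k l : k <= l -> satisfies M (id_alt k) -> satisfies M (id_alt l).
Proof.
move=> /subnK <-; elim: (l - k)%N => // i IH h; rewrite addSn.
exact/alt_succ/IH.
Qed.

(** By absorption, [sq a * sq b] can be rewritten with as many alternations as desired. This is why
    every [id_alt k] implies [id_swap2]. *)
Lemma alternates_swap2 a b c k : alternates a b k (sq a * sq b * c).
Proof.
apply: alternates_mulr.
elim: k => // k IH; rewrite [alternates _ _ _ _]/=.
case: ifP => _.
  exists (sq a), (sq a * sq b); split=> //.
  by rewrite !mulgA sq_absorb -mulgA sq_idem.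
by exists 1, (sq a * sq b); split=> //; rewrite mul1g mulgA sq_idem.
Qed.

Lemma alt_swap2 k : satisfies M (id_alt k) -> satisfies M id_swap2.
Proof.
move=> /satisfies_alt h; apply/satisfies_swap2 => a b c.
exact/h/alternates_swap2.
Qed.

Lemma triv_all e : satisfies M id_triv -> satisfies M e.
Proof. by move=> /satisfies_triv h v; rewrite [LHS]h [RHS]h. Qed.

End SquareCalculus.

(** * Sorting blocks *)

Section BlockEval.
Local Open Scope group_scope.
Variables (M : monoidType).
Implicit Types (v : nat -> M) (B : word) (S : seq (word * nat)).

Lemma sq1 : sq (1 : M) = 1.
Proof. by rewrite sqE mulg1. Qed.

Definition sqs v B : M := eval_word (fun z => sq (v z)) B.

(** Each block is closed by one linear letter; the last block of a word will be closed by a fresh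
    letter with value 1. *)
Fixpoint evalS v S : M :=
  if S is (B, t) :: S' then sqs v B * v t * evalS v S' else 1.

Lemma sqs_cons v z B : sqs v (z :: B) = sq (v z) * sqs v B.
Proof. exact: eval_cons. Qed.

Lemma sqs_cat v B1 B2 : sqs v (B1 ++ B2) = sqs v B1 * sqs v B2.
Proof. exact: eval_cat. Qed.

Lemma sqs_one v B : {in B, forall z, v z = 1} -> sqs v B = 1.
Proof. by move=> h; apply: eval_one => z /h ->; rewrite sq1. Qed.

Lemma eq_in_sqs v1 v2 B : {in B, v1 =1 v2} -> sqs v1 B = sqs v2 B.
Proof. by move=> h; apply: eq_in_eval => z /h ->. Qed.

Lemma evalS_cat v S1 S2 : evalS v (S1 ++ S2) = evalS v S1 * evalS v S2.
Proof. by elim: S1 => [|[B t] S1 IH] /=; rewrite ?mul1g // IH !mulgA. Qed.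

End BlockEval.

Definition letters (S : seq (word * nat)) : word := flatten (unzip1 S).

Lemma eq_in_evalS (M : monoidType) (v1 v2 : nat -> M) S :
  {in letters S, v1 =1 v2} -> {in unzip2 S, v1 =1 v2} -> evalS v1 S = evalS v2 S.
Proof.
elim: S => //= -[B t] S IH /= h1 h2; rewrite h2 ?mem_head //.
rewrite IH => [||z zS]; last by apply: h2; rewrite inE zS orbT.
  by rewrite (@eq_in_sqs _ v1 v2) // => z zB; apply: h1; rewrite /letters /= mem_cat zB.
by move=> z zS; apply: h1; rewrite /letters /= mem_cat zS orbT.
Qed.

(** This is what allows the values of the linear letters to be chosen one by one, independently of
    those of the letters in blocks. *)
Definition separated (S : seq (word * nat)) : bool :=
  uniq (unzip2 S) && ~~ has [in unzip2 S] (letters S).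

Lemma separated_cons B t S : separated ((B, t) :: S) ->
  [/\ separated S, t \notin unzip2 S, t \notin letters S, t \notin B &
      {in B, forall z, z \notin unzip2 S}].
Proof.
rewrite /separated /= => /andP[/andP[tS uS] /hasPn h].
have hl z : z \in B ++ letters S -> z \notin t :: unzip2 S by apply: h.
have tn : t \notin B ++ letters S by apply/negP => /hl; rewrite mem_head.
move: tn; rewrite mem_cat negb_or => /andP[tB tl].
split=> //.
  rewrite uS; apply/hasPn => z zS; apply/negP => zt.
  by have := hl z; rewrite mem_cat zS orbT inE zt orbT => /(_ isT).
by move=> z zB; apply/negP => zt; have := hl z; rewrite mem_cat zB inE zt orbT => /(_ isT).
Qed.

Section BlockSort.
Local Open Scope group_scope.
Variables (M : monoidType).
Hypothesis hM : models basis M.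
Implicit Types (v : nat -> M) (B : word) (S : seq (word * nat)).

Lemma absorb_sqs m a v B : m * sq a = m -> m * sqs v B * sq a = m * sqs v B.
Proof.
elim: B m => [|z B IH] m h; first by rewrite /sqs eval_nil mulg1.
by rewrite sqs_cons !mulgA IH // absorb_mul_sq.
Qed.

Lemma sqs_absorb v B z : z \in B -> sqs v B * sq (v z) = sqs v B.
Proof.
case/splitPr => l r; rewrite sqs_cat sqs_cons !mulgA absorb_sqs //.
by rewrite mul_sq_idem.
Qed.

Lemma sqs_single v B f : f \in B -> {in B, forall z, z != f -> v z = 1} ->
  sqs v B = sq (v f).
Proof.
elim: B => // z B IH; rewrite inE sqs_cons => /orP[/eqP <-|fB] h.
  have [zB|zB] := boolP (f \in B).
    by rewrite IH ?sq_idem // => y yB; apply: h; rewrite inE yB orbT.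
  rewrite sqs_one ?mulg1 // => y yB; apply: h; first by rewrite inE yB orbT.
  by apply: contraNneq zB => <-.
rewrite IH // => [|y yB]; last by apply: h; rewrite inE yB orbT.
have [->|zf] := eqVneq z f; first by rewrite sq_idem.
by rewrite h ?mem_head // sq1 mul1g.
Qed.

Lemma sqs_pair v B x y : uniq B -> x \in B -> y \in B -> index x B < index y B ->
  {in B, forall z, z != x -> z != y -> v z = 1} -> sqs v B = sq (v x) * sq (v y).
Proof.
move=> uB xB yB lt h; move: uB yB lt h; case/splitPr: xB => l r.
rewrite cat_uniq => /and3P[ul /hasPn lr /= /andP[xr ur]].
have xl : x \notin l by apply: lr; rewrite mem_head.
rewrite mem_cat inE !index_cat (negPf xl) /= eqxx addn0.
have [yl|yl] := boolP (y \in l).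
  by move=> _ lt; have := index_mem y l; rewrite yl ltnNge (ltnW lt).
have [->|yx] := eqVneq y x; first by rewrite ?eqxx ?addn0 ?ltnn.
move=> /= yr _ h; rewrite sqs_cat sqs_cons sqs_one ?mul1g; last first.
  move=> z zl; apply: h; rewrite ?mem_cat ?zl //; first by apply: contraNneq xl => <-.
  by apply: contraNneq yl => <-.
congr (_ * _); apply: sqs_single => // z zr zy; apply: h => //.
  by rewrite mem_cat inE zr !orbT.
by apply: contraNneq xr => <-.
Qed.

(** The factor q lets further factors be appended to p, as happens while the squares of a block are
    moved one after the other. *)
Definition commutes_after (p a b : M) := forall q, p * q * sq a * sq b = p * q * sq b * sq a.

Lemma commutes_afterC p a b : commutes_after p a b -> commutes_after p b a.
Proof. by move=> h q; rewrite h. Qed.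

Lemma move_front v p B x : {in B, forall y, commutes_after p (v y) (v x)} ->
  forall q, p * q * sqs v B * sq (v x) = p * q * sq (v x) * sqs v B.
Proof.
elim: B => [|y B IH] h q; first by rewrite /sqs eval_nil !mulg1.
rewrite sqs_cons !mulgA -(mulgA p q) IH; last first.
  by move=> z zB; apply: h; rewrite inE zB orbT.
by rewrite mulgA h ?mem_head.
Qed.

Definition inverted (x y : nat) (B B' : word) : bool :=
  [&& x \in B, y \in B, index x B < index y B & index y B' < index x B'].

(** Selection sort towards B': its head b moves to the front of B past letters that all come after b
    in B', so only inverted pairs are exchanged. *)
Lemma sort_block v p B' B : uniq B -> uniq B' -> B =i B' ->
  (forall x y, inverted x y B B' -> commutes_after p (v x) (v y)) ->
  forall q, p * q * sqs v B = p * q * sqs v B'.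
Proof.
elim: B' B => [|b B' IH] B uB uB' eB h q.
  by case: B eB {uB h} => // z B /(_ z); rewrite mem_head.
have bB : b \in B by rewrite eB mem_head.
move: uB eB h; case/splitPr: bB => l r uB eB h.
have [bl br ulr] : [/\ b \notin l, b \notin r & uniq (l ++ r)].
  by move: uB; rewrite uniq_catC /= uniq_catC mem_cat negb_or andbC => /and3P[].
(* Removing b shifts exactly the letters behind it by one place, so the relative order of the others
   is unchanged. *)
have idx z : z != b -> index z (l ++ b :: r) = (index z (l ++ r) + (size l <= index z (l ++ r)))%N.
  move=> zb; rewrite !index_cat; case: ifP => zl.
    by rewrite leqNgt index_mem zl addn0.
  by rewrite /= eq_sym (negPf zb) leq_addr addnS addn1.
rewrite sqs_cat !sqs_cons !mulgA move_front => [|y yl]; last first.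
  have yb : y != b by apply: contraNneq bl => <-.
  apply: h; rewrite /inverted !mem_cat yl mem_head orbT /=.
  rewrite !index_cat yl (negPf bl) /= !eqxx addn0 index_mem yl /=.
  by rewrite eq_sym (negPf yb).
rewrite -(mulgA _ (sqs v l)) -sqs_cat -(mulgA p q); move: uB' => /= /andP[bB' uB'].
apply: IH => // [z|x y].
  have := eB z; rewrite !mem_cat !inE.
  have [->|//] := eqVneq z b.
  by rewrite (negPf bl) (negPf br) (negPf bB').
case/and4P=> xlr ylr lt lt'; apply: h.
have lrb z : z \in l ++ r -> z != b.
  by apply: contraTneq => ->; rewrite mem_cat negb_or bl.
rewrite /inverted !mem_cat !inE /= !(eq_sym b) !(negPf (lrb _ _)) //=.
rewrite -!mem_cat xlr ylr ltnS lt' andbT !idx ?lrb //=.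
by case: (leqP (size l) (index x _)) => [/leq_trans ->|] /=;
  rewrite ?ltn_add2r ?addn0 ?ltn_addr // ltnW.
Qed.

End BlockSort.

(** The two sides of an identity with the same linear letters in the same order, zipped block by
    block. *)
Definition zblocks := seq (word * word * nat).
Definition lblocks (Z : zblocks) := [seq (b.1.1, b.2) | b <- Z].
Definition rblocks (Z : zblocks) := [seq (b.1.2, b.2) | b <- Z].

Definition wf_block (b : word * word * nat) : Prop :=
  [/\ uniq b.1.1, uniq b.1.2 & b.1.1 =i b.1.2].

(** Blocks are sorted from left to right. The sorted prefix has the same value as the original one,
    which is why commutation after the left-hand blocks suffices. *)
Lemma sort_blocks (M : monoidType) (v : nat -> M) Z (p : M) :
  (forall b, b \in Z -> wf_block b) ->
  (forall Z1 B B' t Z2, Z = Z1 ++ (B, B', t) :: Z2 -> forall x y,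
     inverted x y B B' ->
     commutes_after (p * evalS v (lblocks Z1))%g (v x) (v y)) ->
  (p * evalS v (lblocks Z) = p * evalS v (rblocks Z))%g.
Proof.
elim: Z p => [|[[B B'] t] Z IH] p wf h //=.
have [/= uB uB' eB] : wf_block (B, B', t) by apply: wf; rewrite mem_head.
have e : (p * sqs v B = p * sqs v B')%g.
  have := @sort_block _ v p B' B uB uB' eB _ 1%g; rewrite mulg1; apply.
  move=> x y i; have := h [::] B B' t Z erefl x y i; by rewrite /= mulg1.
rewrite !mulgA e; apply: IH => [b bZ|Z1 C C' s Z2 eZ x y i].
  by apply: wf; rewrite inE bZ orbT.
have := h ((B, B', t) :: Z1) C C' s Z2 _ x y i; rewrite eZ => /(_ erefl) /=.
by rewrite !mulgA e.
Qed.

(** * Alternations between two letters *)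

(* [alt_blocks f g k S]: no block of S contains both letters, and, read from
   the right, the blocks of S containing one of them alternate k times between
   them, the leftmost such block containing f *)
Inductive alt_blocks : nat -> nat -> nat -> seq (word * nat) -> Prop :=
| AltNil f g : alt_blocks f g 0 [::]
| AltSkip f g k B t S : f \notin B -> g \notin B ->
    alt_blocks f g k S -> alt_blocks f g k ((B, t) :: S)
| AltSame f g k B t S : f \in B -> g \notin B ->
    alt_blocks f g k.+1 S -> alt_blocks f g k.+1 ((B, t) :: S)
| AltNew f g k B t S : f \notin B -> g \in B ->
    alt_blocks f g k S -> alt_blocks g f k.+1 ((B, t) :: S).

Definition shares (x y : nat) (S : seq (word * nat)) : bool :=
  has (fun b => (x \in b.1) && (y \in b.1)) S.

Lemma alt_blocks0 f g S : alt_blocks f g 0 S -> alt_blocks g f 0 S.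
Proof.
move e: 0 => k h; elim: h e => {f g k S} // [f g _|f g k B t S fB gB _ IH /IH h].
  exact: AltNil.
exact: AltSkip.
Qed.

Lemma alt_blocks_exists x y S : ~~ shares x y S ->
  exists k, alt_blocks x y k S \/ alt_blocks y x k S.
Proof.
elim: S => [|[B t] S IH] /=; first by exists 0; left; apply: AltNil.
rewrite negb_or => /andP[xyB /IH [k hk]]; move: xyB.
have [xB|xB] := boolP (x \in B); have [yB|yB] := boolP (y \in B) => // _.
- case: hk => [|h]; last by exists k.+1; left; apply: AltNew.
  case: k => [/alt_blocks0 h|k h]; first by exists 1; left; apply: AltNew.
  by exists k.+1; left; apply: AltSame.
- case: hk => [h|]; first by exists k.+1; right; apply: AltNew.
  case: k => [/alt_blocks0 h|k h]; first by exists 1; right; apply: AltNew.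
  by exists k.+1; right; apply: AltSame.
- by exists k; case: hk => h; [left|right]; apply: AltSkip.
Qed.

Section Alternation.
Local Open Scope group_scope.
Variables (M : monoidType).
Hypothesis hM : models basis M.
Implicit Types (v : nat -> M) (B : word) (S : seq (word * nat)).

Lemma sqs_split v B z : z \in B -> exists p q, sqs v B = p * sq (v z) * q.
Proof.
case/splitPr => l r; exists (sqs v l), (sqs v r).
by rewrite sqs_cat sqs_cons !mulgA.
Qed.

(** [alternates] fixes the letter of the rightmost square, [alt_blocks] that of the leftmost block;
    the parity of k converts one convention into the other. *)
Lemma alternates_evalS v f g k S : alt_blocks f g k S ->
  alternates (if odd k then v g else v f) (if odd k then v f else v g) k
    (evalS v S).
Proof.
elim=> {f g k S} [//|f g k B t S _ _ _ IH|f g k B t S _ _ _ IH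
  |f g k B t S _ gB _ IH].
- exact: alternates_mull.
- exact: alternates_mull.
have [p [q e]] := sqs_split v gB.
exists p, (q * v t * evalS v S); rewrite [evalS _ _]/= e !mulgA; split.
  by case: (odd k.+1).
by apply: alternates_mull; move: IH => /=; case: (odd k).
Qed.

Lemma alternates_commutes k (a b m : M) : satisfies M (id_alt k) ->
  alternates a b k m -> commutes_after m a b.
Proof.
by move=> /satisfies_alt h am q; apply: h; apply: alternates_mulr.
Qed.

Lemma alt_blocks_commutes v f g k S : satisfies M (id_alt k) ->
  alt_blocks f g k S -> commutes_after (evalS v S) (v f) (v g).
Proof.
move=> hk /(alternates_evalS v) /(alternates_commutes hk).
by case: (odd k) => // /commutes_afterC.
Qed.

(** A block containing x and y absorbs [sq (v x) * sq (v y)], which supplies the left-hand pair of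
    [id_swap2]. *)
Lemma shares_commutes v x y S : satisfies M id_swap2 -> shares x y S ->
  commutes_after (evalS v S) (v x) (v y).
Proof.
move=> /satisfies_swap2 h; elim: S => //= -[B t] S IH /orP[/= /andP[xB yB]|/IH {}IH].
  move=> q; rewrite -(sqs_absorb hM v yB) -(sqs_absorb hM v xB).
  have := h (v x) (v y) (v t * evalS v S * q); rewrite !mulgA => e.
  by rewrite -!mulgA; congr (_ * _); rewrite !mulgA.
by move=> q; rewrite -!mulgA; congr (_ * (_ * _)); rewrite !mulgA.
Qed.

(** A linear letter after which the alternation changes receives the left factor of the shorter
    alternation; the other linear letters are sent to 1. The last clause serves the induction:
    successive blocks with the same letter contribute its square only once. *)
Lemma alternates_eval_blocks f g k S (a b m : M) : f != g ->
  separated S -> f \notin unzip2 S -> g \notin unzip2 S ->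
  alt_blocks f g k S -> alternates a b k m ->
  exists q v, [/\ v f = (if odd k then b else a),
    v g = (if odd k then a else b),
    forall z, z != f -> z != g -> z \notin unzip2 S -> v z = 1,
    m = q * evalS v S &
    0 < k -> sq (v f) * evalS v S = evalS v S].
Proof.
move=> fg sS fS gS h.
have upd (v : nat -> M) t c S' : t \notin unzip2 S' -> t \notin letters S' ->
    evalS (fun z => if z == t then c else v z) S' = evalS v S'.
  by move=> tS tl; apply: eq_in_evalS => z zS; case: eqP => // zt;
    rewrite -zt zS in tl tS.
elim: h m fg sS fS gS => {f g k S} [f g|f g k B t S fB gB _ IH
    |f g k B t S fB gB _ IH|f g k B t S fB gB _ IH] m fg sS fS gS.
- move=> _; exists m, (fun z => if z == f then a else if z == g then b else 1).
  rewrite eqxx eq_sym (negPf fg) eqxx mulg1; split=> // z zf zg _.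
  by rewrite (negPf zf) (negPf zg).
- have [sS' tS tl tB BS] := separated_cons sS.
  move: fS gS; rewrite /= !inE !negb_or => /andP[ft fS] /andP[gt gS].
  move=> /(IH _ fg sS' fS gS) [q [v [vf vg v1 em ef]]].
  have e1 : sqs (fun z => if z == t then 1 else v z) B = 1.
    apply: sqs_one => z zB; case: eqP => // _; apply: v1; last exact: BS.
      by apply: contraNneq fB => <-.
    by apply: contraNneq gB => <-.
  exists q, (fun z => if z == t then 1 else v z).
  rewrite /= (negPf ft) (negPf gt) eqxx e1 upd // !mul1g.
  split=> // z zf zg; rewrite inE negb_or => /andP[/negPf-> zS].
  exact: v1.
- have [sS' tS tl tB BS] := separated_cons sS.
  move: fS gS; rewrite /= !inE !negb_or => /andP[ft fS] /andP[gt gS].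
  move=> /(IH _ fg sS' fS gS) [q [v [vf vg v1 em ef]]].
  have e1 : sqs (fun z => if z == t then 1 else v z) B = sq (v f).
    rewrite (@sqs_single _ hM _ _ f) //= ?(negPf ft) // => z zB zf.
    case: eqP => // _; apply: v1 => //; last exact: BS.
    by apply: contraNneq gB => <-.
  exists q, (fun z => if z == t then 1 else v z).
  rewrite /= (negPf ft) (negPf gt) eqxx e1 upd // mulg1 ef //.
  split=> // z zf zg; rewrite inE negb_or => /andP[/negPf-> zS].
  exact: v1.
- have [sS' tS tl tB BS] := separated_cons sS.
  move: fS gS; rewrite /= !inE !negb_or => /andP[gt gS] /andP[ft fS].
  move=> [q' [m' [-> am']]]; rewrite eq_sym in fg.
  have [q [v [vf vg v1 em ef]]] := IH _ fg sS' fS gS am'.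
  have e1 : sqs (fun z => if z == t then q else v z) B = sq (v g).
    rewrite (@sqs_single _ hM _ _ g) //= ?(negPf gt) // => z zB zg.
    case: eqP => [zt|_]; first by rewrite -zt zB in tB.
    apply: v1 => //; last exact: BS.
    by apply: contraNneq fB => <-.
  exists q', (fun z => if z == t then q else v z).
  rewrite /= (negPf ft) (negPf gt) eqxx e1 upd // em vf vg.
  split=> // [| |z zg zf||_]; last by rewrite !mulgA sq_idem.
  + by case: (odd k).
  + by case: (odd k).
  + by rewrite inE negb_or => /andP[/negPf-> zS]; apply: v1.
  + by rewrite !mulgA; case: (odd k).
Qed.

End Alternation.

(** * Identities extracted from an inversion *)

Definition zequal (V : monoid_class) (Z : zblocks) : Prop :=
  forall (M : monoidType) (v : nat -> M), V M -> evalS v (lblocks Z) = evalS v (rblocks Z).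

Lemma ticks_lblocks Z : unzip2 (lblocks Z) = [seq b.2 | b <- Z].
Proof. by rewrite /unzip2 /lblocks -map_comp. Qed.

Lemma ticks_rblocks Z : unzip2 (rblocks Z) = [seq b.2 | b <- Z].
Proof. by rewrite /unzip2 /rblocks -map_comp. Qed.

Section PairRestriction.
Local Open Scope group_scope.
Variables (M : monoidType).
Hypothesis hM : models basis M.
Implicit Types (v : nat -> M) (B : word) (S : seq (word * nat)).

(* Only the order in which x and y first occur survives when the other letters
   are sent to 1 *)
Lemma sqs_eq_pair v x y B B' : wf_block (B, B', 0) ->
  ~~ inverted x y B B' -> ~~ inverted y x B B' ->
  {in B, forall z, z != x -> z != y -> v z = 1} -> sqs v B = sqs v B'.
Proof.
case=> /= uB uB' eB; rewrite /inverted => nxy nyx h.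
have h' : {in B', forall z, z != x -> z != y -> v z = 1}.
  by move=> z; rewrite -eB; apply: h.
have [xB|xB] := boolP (x \in B); last first.
  have [yB|yB] := boolP (y \in B); last first.
    have n z : z \in B -> (z != x) * (z != y).
      by move=> zB; split; [apply: contraNneq xB|apply: contraNneq yB] => <-.
    rewrite !sqs_one // => z zB; first by rewrite -eB in zB; apply: h; rewrite ?n.
    by apply: h; rewrite ?n.
  rewrite !(@sqs_single _ hM _ _ y) -?eB // => z zB zy.
    by apply: h' => //; apply: contraNneq xB => <-; rewrite eB.
  by apply: h => //; apply: contraNneq xB => <-.
have [yB|yB] := boolP (y \in B); last first.
  rewrite !(@sqs_single _ hM _ _ x) -?eB // => z zB zx.
    by apply: h' => //; apply: contraNneq yB => <-; rewrite eB.
  by apply: h => //; apply: contraNneq yB => <-.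
have [exy|xy] := eqVneq x y.
  rewrite !(@sqs_single _ hM _ _ x) -?eB // => z zB zx.
    by apply: h'; rewrite -?exy.
  by apply: h; rewrite -?exy.
have xB' : x \in B' by rewrite -eB.
have yB' : y \in B' by rewrite -eB.
have ne C : x \in C -> y \in C -> index x C != index y C.
  by move=> xC yC; apply: contra_neq xy => e; rewrite -(nth_index x xC) e nth_index.
rewrite xB yB /= in nxy nyx.
have [lt|gt|e] := ltngtP (index x B) (index y B); last by have := ne B xB yB; rewrite e eqxx.
  rewrite lt /= in nxy; have lt' : index x B' < index y B' by rewrite ltn_neqAle ne //= leqNgt.
  by rewrite !(@sqs_pair _ hM _ _ x y).
rewrite gt /= in nyx.
have lt' : index y B' < index x B' by rewrite ltn_neqAle eq_sym ne //= leqNgt.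
by rewrite !(@sqs_pair _ hM _ _ y x) // => z zB zy zx; [apply: h'|apply: h].
Qed.

(** This makes the part to the right of an inverted block disappear. *)
Lemma absorb_evalS m v x y S : m * sq (v x) = m -> m * sq (v y) = m ->
  {in letters S, forall z, z != x -> z != y -> v z = 1} ->
  {in unzip2 S, forall t, v t = 1} -> m * evalS v S = m.
Proof.
move=> mx my; elim: S => [|[B t] S IH] h1 h2 /=; first by rewrite mulg1.
rewrite (h2 t) ?mem_head // mulg1 mulgA.
have -> : m * sqs v B = m.
  have {h1} : {in B, forall z, z != x -> z != y -> v z = 1}.
    by move=> z zB; apply: h1; rewrite /letters /= mem_cat zB.
  elim: B {h2 IH} => [|z B IHB] h; first by rewrite /sqs eval_nil mulg1.
  rewrite sqs_cons mulgA; suff -> : m * sq (v z) = m.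
    by apply: IHB => z' zB; apply: h; rewrite inE zB orbT.
  have [->//|zx] := eqVneq z x; have [->//|zy] := eqVneq z y.
  by rewrite h ?mem_head // sq1 mulg1.
apply: IH => z zS; first by apply: h1; rewrite /letters /= mem_cat zS orbT.
by apply: h2; rewrite inE zS orbT.
Qed.

End PairRestriction.

Definition inverted_in x y (b : word * word * nat) : bool :=
  inverted x y b.1.1 b.1.2 || inverted y x b.1.1 b.1.2.

Lemma letters_mem (Z : zblocks) b z : b \in Z -> z \in b.1.1 -> z \in letters (lblocks Z).
Proof.
move=> bZ zb; apply/flattenP; exists b.1.1 => //.
by rewrite /unzip1 /lblocks -map_comp; apply: (map_f _ bZ).
Qed.

Lemma lblocks_cat Z1 Z2 : lblocks (Z1 ++ Z2) = lblocks Z1 ++ lblocks Z2.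
Proof. exact: map_cat. Qed.

Lemma rblocks_cat Z1 Z2 : rblocks (Z1 ++ Z2) = rblocks Z1 ++ rblocks Z2.
Proof. exact: map_cat. Qed.

Lemma letters_cat S1 S2 : letters (S1 ++ S2) = letters S1 ++ letters S2.
Proof. by rewrite /letters /unzip1 map_cat flatten_cat. Qed.

Lemma letters_rblocks Z : (forall b, b \in Z -> wf_block b) ->
  letters (rblocks Z) =i letters (lblocks Z).
Proof.
elim: Z => //= b Z IH h z; rewrite /letters /= !mem_cat -/(letters _) IH.
  by have [_ _ ->] := h b (mem_head _ _).
by move=> c cZ; apply: h; rewrite inE cZ orbT.
Qed.

Section Inversion.
Variables (V : monoid_class) (Z Z1 Z2 : zblocks) (B B' : word) (t x y : nat).
Hypothesis hV : class_incl V (models basis).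
Hypothesis VZ : zequal V Z.
Hypothesis sepZ : separated (lblocks Z).
Hypothesis wfZ : forall b, b \in Z -> wf_block b.
Hypothesis eZ : Z = Z1 ++ (B, B', t) :: Z2.
Hypothesis inv : inverted x y B B'.
Hypothesis noinv : forall b, b \in Z1 -> ~~ inverted_in x y b.

Let bZ : (B, B', t) \in Z.
Proof. by rewrite eZ mem_cat mem_head orbT. Qed.

Let not_tick z : z \in letters (lblocks Z) -> z \notin [seq b.2 | b <- Z].
Proof.
move: sepZ => /andP[_ /hasPn h] /h.
by rewrite /= ticks_lblocks.
Qed.

Let xN : x \notin [seq b.2 | b <- Z].
Proof. by apply/not_tick/(letters_mem bZ); case/and4P: inv. Qed.

Let yN : y \notin [seq b.2 | b <- Z].
Proof. by apply/not_tick/(letters_mem bZ); case/and4P: inv. Qed.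

Let ticksE : [seq b.2 | b <- Z] = [seq b.2 | b <- Z1] ++ t :: [seq b.2 | b <- Z2].
Proof. by rewrite eZ map_cat. Qed.

Let ticks_uniq : uniq [seq b.2 | b <- Z].
Proof. by move: sepZ => /andP[]; rewrite ticks_lblocks. Qed.

(** No earlier block inverts x and y, so the prefixes of the two sides agree for arbitrary values of
    the linear letters. *)
Lemma evalS_prefix (M : monoidType) (v : nat -> M) : models basis M ->
  {in letters (lblocks Z), forall z, z != x -> z != y -> v z = 1%g} ->
  evalS v (rblocks Z1) = evalS v (lblocks Z1).
Proof.
move=> hM v1.
have : {subset Z1 <= Z} by move=> b bZ1; rewrite eZ mem_cat bZ1.
elim: Z1 noinv => //= -[[C C'] s] Y IH ni sY.
have := ni _ (mem_head _ _); rewrite /inverted_in negb_or => /= /andP[n1 n2].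
have CZ : (C, C', s) \in Z by apply/sY/mem_head.
rewrite IH => [|b bY|b bY]; try by [apply: ni; rewrite inE bY orbT|
  apply: sY; rewrite inE bY orbT].
rewrite (@sqs_eq_pair _ hM v x y C C') //; first exact: wfZ CZ.
by move=> z zC; apply: v1; apply: letters_mem CZ _.
Qed.

(** The inverted block becomes the two squares in either order. The tails are absorbed because the
    linear letters from this block on are sent to 1, while those of the prefix remain free. *)
Lemma restrict_pair (M : monoidType) (v : nat -> M) : V M ->
  {in letters (lblocks Z), forall z, z != x -> z != y -> v z = 1%g} ->
  v t = 1%g -> {in [seq b.2 | b <- Z2], forall s, v s = 1%g} ->
  (evalS v (lblocks Z1) * sq (v x) * sq (v y) =
   evalS v (lblocks Z1) * sq (v y) * sq (v x))%g.
Proof.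
move=> VM v1 vt v2; have hM := hV VM.
have := VZ v VM; rewrite eZ lblocks_cat rblocks_cat !evalS_cat /=.
have [uB uB' eB] := wfZ bZ; rewrite /= in uB uB' eB.
case/and4P: inv => xB yB lt lt'.
have vB : {in B, forall z, z != x -> z != y -> v z = 1%g}.
  by move=> z zB; apply: v1; apply: letters_mem bZ _.
rewrite evalS_prefix // (@sqs_pair _ hM _ _ x y) // (@sqs_pair _ hM _ B' y x) -?eB //;
  last by move=> z zB zy zx; apply: vB => //; rewrite eB.
rewrite vt !mulg1 !mulgA.
have sub z : z \in letters (lblocks Z2) -> z \in letters (lblocks Z).
  by move=> zZ; rewrite eZ lblocks_cat letters_cat mem_cat /letters /= mem_cat zZ !orbT.
have wf2 b : b \in Z2 -> wf_block b.
  by move=> b2; apply: wfZ; rewrite eZ mem_cat inE b2 !orbT.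
have abs_ab (a b : M) : (sq a * sq b * sq a = sq a * sq b)%g := sq_absorb hM a b.
have abs_bb (a b : M) : (sq a * sq b * sq b = sq a * sq b)%g.
  by rewrite -mulgA sq_idem.
have R1 : (sq (v x) * sq (v y) * evalS v (lblocks Z2) = sq (v x) * sq (v y))%g.
  apply: (@absorb_evalS _ _ v x y) => // [z /sub|]; first exact: v1.
  by rewrite ticks_lblocks.
have R2 : (sq (v y) * sq (v x) * evalS v (rblocks Z2) = sq (v y) * sq (v x))%g.
  apply: (@absorb_evalS _ _ v x y) => // [z|]; last by rewrite ticks_rblocks.
  by rewrite letters_rblocks // => /sub; apply: v1.
by rewrite -!(mulgA (evalS v (lblocks Z1))) -!mulgA !(mulgA (sq _)) R1 R2.
Qed.

(** Up to a left factor, [alternates_eval_blocks] realises every alternating m as a value of the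
    prefix. The equation obtained is symmetric in the two letters, so the parity of k does no
    harm. *)
Lemma extract_alt f g k : [\/ f = x /\ g = y | f = y /\ g = x] ->
  alt_blocks f g k (lblocks Z1) -> holds_in V (id_alt k).
Proof.
move=> fgE alt M VM; have hM := hV VM; apply/satisfies_alt => a b m am.
have xy : x != y.
  by apply: contraTneq inv => <-; rewrite /inverted ltnn !andbF.
have fg : f != g by case: fgE => -[-> ->] //; rewrite eq_sym.
have : [seq b.2 | b <- Z1] = unzip2 (lblocks Z1) by rewrite ticks_lblocks.
move=> tE; have sep1 : separated (lblocks Z1).
  move: sepZ; rewrite /separated eZ lblocks_cat letters_cat has_cat /unzip2 map_cat cat_uniq.
  case/andP=> /andP[-> _]; rewrite negb_or => /andP[/hasPn h _].
  by apply/hasPn => z /h; rewrite /= mem_cat negb_or => /andP[].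
have fN : f \notin unzip2 (lblocks Z1).
  rewrite -tE; have : f \notin [seq b.2 | b <- Z] by case: fgE => -[-> _].
  by rewrite ticksE mem_cat negb_or => /andP[].
have gN : g \notin unzip2 (lblocks Z1).
  rewrite -tE; have : g \notin [seq b.2 | b <- Z] by case: fgE => -[_ ->].
  by rewrite ticksE mem_cat negb_or => /andP[].
have [q [v [vf vg v1 -> _]]] := alternates_eval_blocks hM fg sep1 fN gN alt am.
have v1' z : z != x -> z != y -> z \notin unzip2 (lblocks Z1) -> v z = 1%g.
  by move=> zx zy zS; apply: v1 => //; case: fgE => -[ef eg]; rewrite ?ef ?eg.
have nt s : s \in t :: [seq b.2 | b <- Z2] -> v s = 1%g.
  move=> sZ; have sZ' : s \in [seq b.2 | b <- Z] by rewrite ticksE mem_cat sZ orbT.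
  apply: v1'; try by [apply: contraNneq xN => <-|apply: contraNneq yN => <-].
  move: ticks_uniq; rewrite ticksE cat_uniq => /and3P[_ /hasPn h _].
  by rewrite -tE; apply: h.
have : (evalS v (lblocks Z1) * sq (v x) * sq (v y) =
   evalS v (lblocks Z1) * sq (v y) * sq (v x))%g.
  apply: restrict_pair => // [z zZ zx zy| |s sZ].
  - apply: v1' => //; rewrite -tE; have := not_tick zZ.
    by rewrite ticksE mem_cat negb_or => /andP[].
  - exact/nt/mem_head.
  - by apply: nt; rewrite inE sZ orbT.
have [[-> ->]|[-> ->]] : [\/ v x = a /\ v y = b | v x = b /\ v y = a].
  by case: fgE vf vg => -[-> ->] -> ->; case: (odd k); [right|left|left|right].
all: by move=> e; rewrite -!mulgA; congr (q * _)%g; rewrite !mulgA.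
Qed.

(** The last linear letter of the prefix is sent to c. Multiplying by [sq a * sq b] on the left then
    absorbs the rest of the prefix. With an empty prefix even [id_alt 0] holds. *)
Lemma extract_swap2 : holds_in V id_swap2.
Proof.
have xy : x != y.
  by apply: contraTneq inv => <-; rewrite /inverted ltnn !andbF.
have [e1|[Y [C [C' [s e1]]]]] :
    Z1 = [::] \/ exists Y C C' s, Z1 = rcons Y (C, C', s).
  case/lastP: (Z1) => [|Y [[C C'] s]]; first by left.
  by right; exists Y, C, C', s.
  move=> M VM; have hM := hV VM; apply/(@alt_swap2 _ hM 0).
  apply: (@extract_alt x y 0) => //; first by left.
  by rewrite e1; apply: AltNil.
move=> M VM; have hM := hV VM; apply/satisfies_swap2 => a b c.
pose v z := if z == x then a else if z == y then b else if z == s then c else 1%g.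
have sZ : s \in [seq b.2 | b <- Z1] by rewrite e1 map_rcons mem_rcons mem_head.
have sZ' : s \in [seq b.2 | b <- Z] by rewrite ticksE mem_cat sZ.
have vx : v x = a by rewrite /v eqxx.
have vy : v y = b by rewrite /v eq_sym (negPf xy) eqxx.
have vs : v s = c.
  rewrite /v eqxx; have [e|_] := eqVneq s x; first by move: xN; rewrite -e sZ'.
  by have [e|_] := eqVneq s y; first by move: yN; rewrite -e sZ'.
have v1 z : z != x -> z != y -> z != s -> v z = 1%g.
  by rewrite /v => /negPf-> /negPf-> /negPf->.
have v1t z : z \in [seq b.2 | b <- Z] -> z != s -> v z = 1%g.
  move=> zZ zs; apply: v1 => //.
    by apply: contraNneq xN => <-.
  by apply: contraNneq yN => <-.
have vl : {in letters (lblocks Z), forall z, z != x -> z != y -> v z = 1%g}.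
  move=> z /not_tick zZ zx zy; apply: v1 => //.
  by apply: contraNneq zZ => ->.
have us z : z \in t :: [seq b.2 | b <- Z2] -> z != s.
  move: ticks_uniq; rewrite ticksE cat_uniq => /and3P[_ /hasPn h _] /h.
  by apply: contraNneq => ->.
have vt : v t = 1%g.
  by apply: v1t; rewrite ?us ?mem_head // ticksE mem_cat mem_head orbT.
have v2 : {in [seq b.2 | b <- Z2], forall s, v s = 1%g}.
  move=> z zZ; apply: v1t; first by rewrite ticksE mem_cat inE zZ !orbT.
  by apply: us; rewrite inE zZ orbT.
have := restrict_pair VM vl vt v2; rewrite vx vy => e.
have E : evalS v (lblocks Z1) =
   (evalS v (lblocks Y) * (sqs v C * c))%g.
  by rewrite e1 -cats1 lblocks_cat evalS_cat /= vs mulg1.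
have eY : (sq a * sq b * evalS v (lblocks Y) * sqs v C = sq a * sq b)%g.
  (* The last block C of the prefix is closed here by t, whose value is 1, instead of s, whose value
     is c. *)
  have := @absorb_evalS _ (sq a * sq b)%g v x y (lblocks Y ++ [:: (C, t)]).
  rewrite evalS_cat /= vt !mulg1 !mulgA; apply.
  - by rewrite vx sq_absorb.
  - by rewrite vy -mulgA sq_idem.
  - move=> z; rewrite letters_cat mem_cat {2}/letters /= cats0 => zY.
    apply: vl; rewrite eZ e1 lblocks_cat letters_cat mem_cat -cats1 lblocks_cat.
    have eC : letters (lblocks [:: (C, C', s)]) = C by rewrite /letters /= cats0.
    by rewrite letters_cat mem_cat eC zY.
  - move=> z; rewrite /unzip2 map_cat mem_cat -/(unzip2 _) ticks_lblocks.
    rewrite inE => /orP[zY|/eqP ->]; last first.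
      exact: vt.
    apply: v1t; first by rewrite ticksE mem_cat e1 map_rcons mem_rcons inE zY !orbT.
    move: ticks_uniq; rewrite ticksE cat_uniq e1 map_rcons rcons_uniq => /and3P[/andP[h _] _ _].
    by apply: contraNneq h => <-.
have : (sq a * sq b * evalS v (lblocks Z1) = sq a * sq b * c)%g.
  by rewrite E !mulgA eY.
by move=> <-; rewrite -!mulgA; congr (_ * (_ * _))%g; rewrite !mulgA.
Qed.

End Inversion.

(** * Normalization and saturation of words *)

Lemma inverted_inC x y b : inverted_in x y b = inverted_in y x b.
Proof. exact: orbC. Qed.

(** An inversion is undone in M by an identity forced on V by the first inversion of the same
    letters: [id_swap2] if they share an earlier block, otherwise [id_alt k] with k the number of
    alternations in the prefix. *)
Lemma zequal_transfer (V : monoid_class) (M : monoidType) (Z : zblocks) :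
  class_incl V (models basis) -> models basis M ->
  (forall k, holds_in V (id_alt k) -> satisfies M (id_alt k)) ->
  (holds_in V id_swap2 -> satisfies M id_swap2) ->
  (forall b, b \in Z -> wf_block b) -> separated (lblocks Z) -> zequal V Z ->
  forall v : nat -> M, evalS v (lblocks Z) = evalS v (rblocks Z).
Proof.
move=> hV hM Malt Mswap wfZ sepZ VZ v.
have := @sort_blocks M v Z 1%g wfZ; rewrite !mul1g; apply.
move=> Z1 B B' t Z2 eZ x y i; rewrite mul1g.
have first_swap C C' s Y1 Y2 x' y' : Z = Y1 ++ (C, C', s) :: Y2 ->
    inverted x' y' C C' -> ~~ has (inverted_in x' y') Y1 -> holds_in V id_swap2.
  move=> eY i' /hasPn ni.
  exact: (extract_swap2 hV VZ sepZ wfZ eY i' ni).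
have [h|nh] := boolP (has (inverted_in x y) Z1).
  apply: shares_commutes => //.
    apply: Mswap; move: eZ; case/split_find: h => -[[C C'] s] Y1 Y2 iC nY.
    rewrite cat_rcons -catA => eY.
    case/orP: iC => iC; first exact: (first_swap _ _ _ _ _ _ _ eY iC nY).
    apply: (first_swap _ _ _ _ _ _ _ eY iC).
    by rewrite (eq_has (inverted_inC y x)).
  case/hasP: h => b bZ1 ib; apply/hasP; exists (b.1.1, b.2).
    exact: (map_f (fun b => (b.1.1, b.2))).
  by case/orP: ib => /and4P[-> ->].
have [s|ns] := boolP (shares x y (lblocks Z1)).
  apply: shares_commutes => //; apply: Mswap.
  exact: (first_swap _ _ _ _ _ _ _ eZ i nh).
have [k hk] := alt_blocks_exists ns.
have /hasPn ni := nh.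
case: hk => hk.
  apply: (alt_blocks_commutes _ (Malt k _) hk) => //.
  by apply: (extract_alt hV VZ sepZ wfZ eZ i ni _ hk); left.
apply/commutes_afterC/(alt_blocks_commutes _ (Malt k _) hk) => //.
by apply: (extract_alt hV VZ sepZ wfZ eZ i ni _ hk); right.
Qed.

(** Keeps first occurrences, since a square is absorbed by an earlier one; [undup] alone keeps last
    occurrences. *)
Definition dedup (B : word) : word := rev (undup (rev B)).

Lemma mem_dedup B : dedup B =i B.
Proof. by move=> z; rewrite mem_rev mem_undup mem_rev. Qed.

Lemma dedup_uniq B : uniq (dedup B).
Proof. by rewrite rev_uniq undup_uniq. Qed.

(** Letters after the last linear letter are lost, so a fresh linear letter is always appended
    before parsing. *)
Fixpoint parse (ns : pred nat) (acc w : word) : seq (word * nat) :=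
  if w is z :: w' then
    if ns z then parse ns (rcons acc z) w' else (acc, z) :: parse ns [::] w'
  else [::].

Lemma ticks_parse ns acc w : unzip2 (parse ns acc w) = filter (predC ns) w.
Proof. by elim: w acc => //= z w IH acc; case: (ns z) => //=; rewrite IH. Qed.

Lemma letters_parse ns acc w N : ~~ ns N ->
  letters (parse ns acc (rcons w N)) = acc ++ filter ns w.
Proof.
move=> nN; elim: w acc => [|z w IH] acc /=.
  by rewrite (negPf nN) /letters /= !cats0.
case: (ns z); first by rewrite IH cat_rcons.
by rewrite /letters /= -/(letters _) IH.
Qed.

(** The flags l, r, m stand for [id_left], [id_right], [id_mid]; p and q tell whether the letter
    occurs in blocks to the left and to the right. *)
Definition allowed (l r m p q : bool) := [|| l && p, r && q | [&& m, p & q]].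

(** Both P and [letters S'] refer to the original blocks, so what is inserted into one block does
    not depend on insertions into the others. *)
Fixpoint sat l r m (L P : word) (S : seq (word * nat)) : seq (word * nat) :=
  if S is (B, t) :: S' then
    (dedup (B ++ [seq z <- L | allowed l r m (z \in P) (z \in letters S')]), t)
      :: sat l r m L (P ++ B) S'
  else [::].

Lemma ticks_sat l r m L P S : unzip2 (sat l r m L P S) = unzip2 S.
Proof. by elim: S P => //= -[B t] S IH P /=; rewrite IH. Qed.

Lemma letters_sat l r m L P S : {subset letters S <= L} ->
  {subset letters (sat l r m L P S) <= L}.
Proof.
elim: S P => //= -[B t] S IH P sub z; rewrite /letters /= mem_cat mem_dedup.
have sB y : y \in B -> y \in L by move=> yB; apply: sub; rewrite /letters /= mem_cat yB.
have sS y : y \in letters S -> y \in L.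
  by move=> yB; apply: sub; rewrite /letters /= mem_cat yB orbT.
rewrite mem_cat mem_filter => /orP[/orP[/sB//|/andP[]//]|]; exact: IH.
Qed.

Section Normalization.
Local Open Scope group_scope.
Variables (M : monoidType).
Hypothesis hM : models basis M.
Implicit Types (v : nat -> M) (B : word) (S : seq (word * nat)).

Lemma sqs_dedup v B : sqs v (dedup B) = sqs v B.
Proof.
elim/last_ind: B => // B z IH; rewrite /dedup rev_rcons /= mem_rev.
case: ifP => zB; rewrite -cats1 sqs_cat sqs_cons /sqs eval_nil mulg1 -!/(sqs _ _).
  by rewrite -/(dedup B) IH sqs_absorb.
by rewrite rev_cons -cats1 sqs_cat -/(dedup B) IH sqs_cons /sqs eval_nil mulg1.
Qed.

Lemma duplicate_letter v p z q : (1 < count_mem z (p ++ z :: q))%N ->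
  eval_word v p * v z * eval_word v q = eval_word v p * sq (v z) * eval_word v q.
Proof.
rewrite count_cat /= eqxx addnCA add1n ltnS -count_cat -has_count has_pred1.
rewrite mem_cat => /orP[]; case/splitPr => l r; rewrite eval_cat eval_cons !mulgA.
  by rewrite -!(mulgA (eval_word v l)) dup_last // !mulgA.
by rewrite -!(mulgA (eval_word v p)) dup_first // !mulgA.
Qed.

Definition square_on (ns : pred nat) v z := if ns z then sq (v z) else v z.

Lemma eval_square_on v (ns : pred nat) w :
  {in w, forall z, ns z -> 1 < count_mem z w}%N ->
  eval_word v w = eval_word (square_on ns v) w.
Proof.
suff gen q p : {in q, forall z, ns z -> 1 < count_mem z (p ++ q)}%N ->
    eval_word v p * eval_word v q = eval_word v p * eval_word (square_on ns v) q.
  by move=> h; have := gen w [::] h; rewrite eval_nil !mul1g.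
elim: q p => [|z q IH] p h; rewrite ?eval_nil // !eval_cons {1}/square_on !mulgA.
have hz y : y \in q -> ns y -> (1 < count_mem y (p ++ z :: q))%N.
  by move=> yq; apply: h; rewrite inE yq orbT.
case: ifP => nz.
  rewrite duplicate_letter; last by apply: h; rewrite ?mem_head.
  (* The squared letter enters the prefix as two occurrences, so no count decreases. *)
  have := IH (p ++ [:: z; z]); rewrite eval_cat !eval_cons eval_nil mulg1 -sqE.
  apply=> y yq /(hz y yq) /leq_trans; apply.
  by rewrite !count_cat /= -!addnA leq_add2l leq_add2l leq_addl.
have := IH (rcons p z); rewrite -cats1 eval_cat eval_seq1; apply=> y yq /(hz y yq).
by rewrite -catA.
Qed.

Lemma evalS_parse v (ns : pred nat) acc w N : ~~ ns N ->
  evalS v (parse ns acc (rcons w N)) =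
  sqs v acc * eval_word (square_on ns v) w * v N.
Proof.
move=> nN; elim: w acc => [|z w IH] acc /=.
  by rewrite (negPf nN) /= eval_nil !mulg1.
rewrite eval_cons {1}/square_on; case: ifP => nz.
  by rewrite IH -cats1 sqs_cat sqs_cons /sqs eval_nil mulg1 !mulgA.
by rewrite /= IH /sqs eval_nil mul1g !mulgA.
Qed.

Lemma evalS_split v z S : z \in letters S -> exists p q, evalS v S = p * sq (v z) * q.
Proof.
elim: S => //= -[B t] S IH; rewrite /letters /= mem_cat => /orP[/(sqs_split v)|/IH] [p [q e]].
  by exists p, (q * v t * evalS v S); rewrite e !mulgA.
by exists (sqs v B * v t * p), q; rewrite e !mulgA.
Qed.

Section Saturation.
Variables (l r m : bool).
Hypotheses (hl : l -> satisfies M id_left) (hr : r -> satisfies M id_right)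
  (hm : m -> satisfies M id_mid).

Lemma insert_allowed v z p b c (i j : bool) :
  (i -> exists p1 p2, p = p1 * sq (v z) * p2) ->
  (j -> exists q1 q2, c = q1 * sq (v z) * q2) -> allowed l r m i j ->
  p * b * sq (v z) * c = p * b * c.
Proof.
move=> hi hj /or3P[/andP[/hl/(leftP hM) h /hi[p1 [p2 ->]]]|/andP[/hr/(rightP hM) h /hj[q1 [q2 ->]]]|
  /and3P[/hm/(midP hM) h /hi[p1 [p2 ->]] /hj[q1 [q2 ->]]]].
- rewrite -[p1 * _ * p2]mulgA -!(mulgA p1) -[sq _ * p2 * b]mulgA h //.
- by rewrite -[LHS]mulgA; congr (_ * _); rewrite !mulgA h.
- have := h (v z) (p2 * b) q1; rewrite !mulgA => e.
  by rewrite -!mulgA; congr (p1 * _); rewrite !mulgA e.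
Qed.

Lemma evalS_sat v L S P p :
  {in P, forall z, exists p1 p2, p = p1 * sq (v z) * p2} ->
  p * evalS v S = p * evalS v (sat l r m L P S).
Proof.
elim: S P p => //= -[B t] S IH P p hP /=; rewrite sqs_dedup sqs_cat !mulgA.
set L' := filter _ L; have hL' : {in L', forall z, allowed l r m (z \in P) (z \in letters S)}.
  by move=> z; rewrite mem_filter => /andP[].
have e : p * sqs v B * v t * evalS v S = p * sqs v B * sqs v L' * v t * evalS v S.
  elim: L' (sqs v B) hL' => [|z L' IHL] b h; first by rewrite /sqs eval_nil !mulg1.
  rewrite sqs_cons !mulgA -(mulgA p b (sq _)) -IHL => [|y yL]; last first.
    by apply: h; rewrite inE yL orbT.
  rewrite !mulgA -!(mulgA _ (v t)) (@insert_allowed v z p b _ (z \in P) (z \in letters S)) ?h ?mem_head //.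
    exact: hP.
  by move=> /(evalS_split v)[q1 [q2 ->]]; exists (v t * q1), q2; rewrite !mulgA.
rewrite e; apply: IH => z; rewrite mem_cat => /orP[/hP[p1 [p2 ->]]|/(sqs_split v)[p1 [p2 ->]]].
  by exists p1, (p2 * sqs v B * sqs v L' * v t); rewrite !mulgA.
by exists (p * p1), (p2 * sqs v L' * v t); rewrite !mulgA.
Qed.

End Saturation.
End Normalization.

(** * Identities extracted from block contents *)

Section OneLetter.
Local Open Scope group_scope.
Variables (M : monoidType).
Hypothesis hM : models basis M.
Implicit Types (v : nat -> M) (B : word) (S : seq (word * nat)).

Definition sq_if (b : bool) (a : M) : M := if b then sq a else 1.

Lemma sq_if_mul b1 b2 a : sq_if b1 a * sq_if b2 a = sq_if (b1 || b2) a.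
Proof. by case: b1 b2 => -[] /=; rewrite ?mul1g ?mulg1 ?sq_idem. Qed.

Lemma sqs_one_letter v B z : {in B, forall y, y != z -> v y = 1} ->
  sqs v B = sq_if (z \in B) (v z).
Proof.
move=> h; rewrite /sq_if; case: ifP => zB; first exact: sqs_single.
by apply: sqs_one => y yB; apply: h => //; apply: contraFneq zB => <-.
Qed.

Lemma evalS_one_letter v S z : {in letters S, forall y, y != z -> v y = 1} ->
  {in unzip2 S, forall t, v t = 1} -> evalS v S = sq_if (z \in letters S) (v z).
Proof.
elim: S => //= -[B t] S IH h1 h2 /=.
rewrite h2 ?mem_head // mulg1 IH => [|y yS|s sS]; last first.
- by apply: h2; rewrite inE sS orbT.
- by apply: h1; rewrite /letters /= mem_cat yS orbT.
rewrite (@sqs_one_letter v B z) ?sq_if_mul ?/letters /= ?mem_cat // => y yB.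
by apply: h1; rewrite /letters /= mem_cat yB.
Qed.

End OneLetter.

Section Content.
Variables (V : monoid_class) (Z Z1 Z2 : zblocks) (B B' : word) (t z : nat).
Hypothesis hV : class_incl V (models basis).
Hypothesis VZ : zequal V Z.
Hypothesis sepZ : separated (lblocks Z).
Hypothesis eqZ : letters (lblocks Z) =i letters (rblocks Z).
Hypothesis eZ : Z = Z1 ++ (B, B', t) :: Z2.
Hypothesis zZ : z \in letters (lblocks Z).

Let pP := z \in letters (lblocks Z1).
Let pB := z \in B.
Let pQ := z \in letters (lblocks Z2).
Let qP := z \in letters (rblocks Z1).
Let qB := z \in B'.
Let qQ := z \in letters (rblocks Z2).

(** Only z, the linear letter closing the previous block and the one closing this block are not sent
    to 1, which leaves three zones for z on each side. If there is no previous block, c is put in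
    front of both sides. *)
Lemma one_letter_pattern (M : monoidType) (a c d : M) : V M ->
  (sq_if pP a * c * sq_if pB a * d * sq_if pQ a =
   sq_if qP a * c * sq_if qB a * d * sq_if qQ a)%g.
Proof.
move=> VM; have hM := hV VM.
have not_tick y : y \in letters (lblocks Z) -> y \notin [seq b.2 | b <- Z].
  by move: sepZ => /andP[_ /hasPn h] /h; rewrite /= ticks_lblocks.
have ticksE : [seq b.2 | b <- Z] = [seq b.2 | b <- Z1] ++ t :: [seq b.2 | b <- Z2].
  by rewrite eZ map_cat.
have ut : uniq [seq b.2 | b <- Z] by move: sepZ => /andP[]; rewrite ticks_lblocks.
have zt := not_tick _ zZ.
have inl S1 S2 y : y \in letters (S1 ++ S2) = (y \in letters S1) || (y \in letters S2).
  by rewrite letters_cat mem_cat.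
have l1 y : y \in letters (lblocks Z1) -> y \in letters (lblocks Z).
  by move=> h; rewrite eZ lblocks_cat inl h.
have r1 y : y \in letters (rblocks Z1) -> y \in letters (lblocks Z).
  by move=> h; rewrite eqZ eZ rblocks_cat inl h.
have lB y : y \in B -> y \in letters (lblocks Z).
  by move=> h; rewrite eZ lblocks_cat inl /letters /= mem_cat h orbT.
have rB y : y \in B' -> y \in letters (lblocks Z).
  by move=> h; rewrite eqZ eZ rblocks_cat inl /letters /= mem_cat h orbT.
have l2 y : y \in letters (lblocks Z2) -> y \in letters (lblocks Z).
  by move=> h; rewrite eZ lblocks_cat inl /letters /= mem_cat h !orbT.
have r2 y : y \in letters (rblocks Z2) -> y \in letters (lblocks Z).
  by move=> h; rewrite eqZ eZ rblocks_cat inl /letters /= mem_cat h !orbT.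
have tail v : v z = a -> v t = d ->
    {in letters (lblocks Z), forall y, y != z -> v y = 1%g} ->
    {in [seq b.2 | b <- Z2], forall s, v s = 1%g} ->
    (evalS v (lblocks Z1) * sq_if pB a * d * sq_if pQ a =
     evalS v (rblocks Z1) * sq_if qB a * d * sq_if qQ a)%g.
  move=> vz vt v1 v2; have := VZ v VM; rewrite eZ lblocks_cat rblocks_cat !evalS_cat /=.
  have -> : evalS v (lblocks Z2) = sq_if pQ a.
    rewrite (@evalS_one_letter _ hM v _ z) ?vz ?ticks_lblocks // => y /l2.
    exact: v1.
  have -> : evalS v (rblocks Z2) = sq_if qQ a.
    rewrite (@evalS_one_letter _ hM v _ z) ?vz ?ticks_rblocks // => y /r2.
    exact: v1.
  rewrite (@sqs_one_letter _ hM v B z) => [|y /lB]; last exact: v1.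
  rewrite (@sqs_one_letter _ hM v B' z) => [|y /rB]; last exact: v1.
  by rewrite vz vt !mulgA.
have tz : t != z.
  by apply: contraNneq zt => <-; rewrite ticksE mem_cat mem_head orbT.
have tN2 s : s \in [seq b.2 | b <- Z2] -> (s != z) * (s != t).
  move=> sZ; split.
    by apply: contraNneq zt => <-; rewrite ticksE mem_cat inE sZ !orbT.
  move: ut; rewrite ticksE cat_uniq => /and3P[_ _ /= /andP[h _]].
  by apply: contraNneq h => <-.
case/lastP: (Z1) @pP @qP l1 r1 tail ticksE => [|Y [[C C'] s]] pP' qP' l1 r1 tail ticksE.
  rewrite /pP' /qP' /sq_if /= -!/(sq_if _ _) !mul1g -!mulgA; congr (c * _)%g; rewrite !mulgA.
  have := tail (fun y => if y == z then a else if y == t then d else 1%g).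
  rewrite /= !mul1g; apply; rewrite ?eqxx ?(negPf tz) ?eqxx //.
    move=> y /not_tick yN /negPf-> ; case: eqP => // yt.
    by move: yN; rewrite yt ticksE mem_head.
  by move=> y /tN2[/negPf-> /negPf->].
pose v y := if y == z then a else if y == t then d else if y == s then c else 1%g.
have sz : s != z.
  apply: contraNneq zt => <-.
  by rewrite ticksE map_rcons mem_cat mem_rcons mem_head.
have st : s != t.
  move: ut; rewrite ticksE map_rcons cat_uniq => /and3P[_ /hasPn h _].
  have := h t (mem_head _ _); rewrite /= mem_rcons inE negb_or eq_sym.
  by case/andP.
have sN y : y \in [seq b.2 | b <- Y] -> v y = 1%g.
  move=> yY; rewrite /v; case: eqP => [e|_].
    by move: zt; rewrite ticksE map_rcons -e mem_cat mem_rcons inE yY orbT.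
  case: eqP => [e|_].
    move: ut; rewrite ticksE map_rcons cat_uniq => /and3P[_ /hasPn h _].
    have := h t (mem_head _ _); rewrite /= mem_rcons inE negb_or -e.
    by rewrite yY andbF.
  case: eqP => // e.
  by move: ut; rewrite ticksE map_rcons cat_uniq rcons_uniq -e yY.
have vz : v z = a by rewrite /v eqxx.
have vt : v t = d by rewrite /v (negPf tz) eqxx.
have vs : v s = c by rewrite /v (negPf sz) (negPf st) eqxx.
have vl : {in letters (lblocks Z), forall y, y != z -> v y = 1%g}.
  move=> y /not_tick; rewrite ticksE map_rcons mem_cat mem_rcons !inE !negb_or /v.
  by case/and3P=> /andP[/negPf-> _] /negPf-> _ /negPf->.
have := tail v vz vt vl; rewrite /pP' /qP'.
have lr : lblocks (rcons Y (C, C', s)) = lblocks Y ++ [:: (C, s)].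
  by rewrite -cats1 lblocks_cat.
have rr : rblocks (rcons Y (C, C', s)) = rblocks Y ++ [:: (C', s)].
  by rewrite -cats1 rblocks_cat.
rewrite lr rr in l1 r1 *; rewrite !evalS_cat /= vs !mulg1 !mulgA.
have C1 y : y \in C -> y \in letters (lblocks Z).
  by move=> yC; apply: l1; rewrite letters_cat mem_cat /letters /= cats0 yC orbT.
have C2 y : y \in C' -> y \in letters (lblocks Z).
  by move=> yC; apply: r1; rewrite letters_cat mem_cat /letters /= cats0 yC orbT.
rewrite (@sqs_one_letter _ hM v C z) => [|y /C1]; last exact: vl.
rewrite (@sqs_one_letter _ hM v C' z) => [|y /C2]; last exact: vl.
have -> : evalS v (lblocks Y) = sq_if (z \in letters (lblocks Y)) a.
  rewrite (@evalS_one_letter _ hM v _ z) ?vz ?ticks_lblocks // => y yY.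
  by apply/vl/l1; rewrite letters_cat mem_cat yY.
have -> : evalS v (rblocks Y) = sq_if (z \in letters (rblocks Y)) a.
  rewrite (@evalS_one_letter _ hM v _ z) ?vz ?ticks_rblocks // => y yY.
  by apply/vl/r1; rewrite letters_cat mem_cat yY.
have lC W D : z \in letters (W ++ [:: (D, s)]) = (z \in letters W) || (z \in D).
  by rewrite letters_cat mem_cat /letters /= cats0.
rewrite !lC vz !sq_if_mul //; apply=> y h.
rewrite /v; have [/negPf-> /negPf->] := tN2 y h.
case: eqP => // e; move: ut; rewrite ticksE map_rcons cat_uniq => /and3P[_ /hasPn h' _].
by have := h' y; rewrite inE h orbT => /(_ isT); rewrite /= mem_rcons inE e eqxx.
Qed.

Let zE : pP || pB || pQ.
Proof.
by have := zZ; rewrite eZ lblocks_cat letters_cat /letters /= !mem_cat orbA.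
Qed.

Let zE' : qP || qB || qQ.
Proof.
by have := zZ; rewrite eqZ eZ rblocks_cat letters_cat /letters /= !mem_cat orbA.
Qed.

(** Multiplication by [sq a] on the left makes the initial factor [sq_if b a] irrelevant. *)
Let left_of (b b' : bool) :
  (forall (M : monoidType) (a c : M), V M ->
    sq_if b a * c * sq a = sq_if b' a * c)%g -> b' -> holds_in V id_left.
Proof.
move=> h b'1 M VM; have hM := hV VM; apply/(leftP hM) => a c.
have /(congr1 (fun x => sq a * x)%g) := h M a c VM; rewrite b'1 !mulgA sq_idem //.
by case: (b); rewrite /= ?mulg1 ?sq_idem.
Qed.

Let right_of (b b' : bool) :
  (forall (M : monoidType) (a c : M), V M ->
    sq a * c * sq_if b a = c * sq_if b' a)%g -> b' -> holds_in V id_right.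
Proof.
move=> h b'1 M VM; have hM := hV VM; apply/(rightP hM) => a c.
have /(congr1 (fun x => x * sq a)%g) := h M a c VM; rewrite b'1 /= -!mulgA sq_idem //.
by case: (b); rewrite /= ?mul1g ?sq_idem.
Qed.

(** In this and the next three names, [first] means that the linear letter before the block keeps an
    arbitrary value, [last] that the one after it does; the other is sent to 1. *)
Lemma left_of_first : pB || pQ -> ~~ (qB || qQ) -> holds_in V id_left.
Proof.
rewrite negb_or => h /andP[nB nQ]; apply: (@left_of pP qP).
  move=> M a c VM; have := one_letter_pattern a c 1%g VM.
  by rewrite (negPf nB) (negPf nQ) /= !mulg1 -[LHS]mulgA sq_if_mul ?h //; apply: hV.
by move: zE'; rewrite (negPf nB) (negPf nQ) !orbF.
Qed.

Lemma left_of_last : pQ -> ~~ qQ -> holds_in V id_left.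
Proof.
move=> h nQ; apply: (@left_of (pP || pB) (qP || qB)).
  move=> M a c VM; have := one_letter_pattern a 1%g c VM; have hM := hV VM.
  by rewrite h (negPf nQ) !mulg1 !sq_if_mul.
by move: zE'; rewrite (negPf nQ) !orbF.
Qed.

Lemma right_of_first : pP -> ~~ qP -> holds_in V id_right.
Proof.
move=> h nP; apply: (@right_of (pB || pQ) (qB || qQ)).
  move=> M a c VM; have := one_letter_pattern a c 1%g VM; have hM := hV VM.
  by rewrite h (negPf nP) !mulg1 mul1g -!(mulgA _ (sq_if _ a)) !sq_if_mul.
by move: zE'; rewrite (negPf nP).
Qed.

Lemma right_of_last : pP || pB -> ~~ (qP || qB) -> holds_in V id_right.
Proof.
rewrite negb_or => h /andP[nP nB]; apply: (@right_of pQ qQ).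
  move=> M a c VM; have := one_letter_pattern a 1%g c VM; have hM := hV VM.
  by rewrite (negPf nP) (negPf nB) !mulg1 !mul1g sq_if_mul // h.
by move: zE'; rewrite (negPf nP) (negPf nB).
Qed.

Lemma mid_of : pB -> ~~ qB -> qP -> qQ -> holds_in V id_mid.
Proof.
move=> h nB h1 h2 M VM; have hM := hV VM; apply/(midP hM) => a c d.
have /(congr1 (fun x => sq a * x * sq a)%g) := one_letter_pattern a c d VM.
rewrite h h1 h2 (negPf nB) /= !mulg1 !mulgA sq_idem // !mul_sq_idem //.
have -> : (sq a * sq_if pP a = sq a)%g by rewrite /sq_if; case: ifP; rewrite ?mulg1 ?sq_idem.
by rewrite /sq_if; case: ifP => _; rewrite ?mulg1 ?mul_sq_idem.
Qed.

End Content.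

(** * Varieties are determined by their critical identities *)

Definition zip_blocks (S S' : seq (word * nat)) : zblocks :=
  [seq (b.1.1, b.2.1, b.1.2) | b <- zip S S'].

Lemma lblocks_zip S S' : unzip2 S = unzip2 S' -> lblocks (zip_blocks S S') = S.
Proof.
elim: S S' => [|[B t] S IH] [|[B' t'] S'] //= [_ /IH e].
by rewrite -[in RHS]e.
Qed.

Lemma rblocks_zip S S' : unzip2 S = unzip2 S' -> rblocks (zip_blocks S S') = S'.
Proof.
elim: S S' => [|[B t] S IH] [|[B' t'] S'] //= [-> /IH e].
by rewrite -[in RHS]e.
Qed.

Fixpoint zsat l r m (L P P' : word) (Z : zblocks) : zblocks :=
  if Z is (B, B', t) :: Z' then
    (dedup (B ++ [seq z <- L | allowed l r m (z \in P) (z \in letters (lblocks Z'))]),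
     dedup (B' ++ [seq z <- L | allowed l r m (z \in P') (z \in letters (rblocks Z'))]),
     t) :: zsat l r m L (P ++ B) (P' ++ B') Z'
  else [::].

Lemma lblocks_zsat l r m L P P' Z :
  lblocks (zsat l r m L P P' Z) = sat l r m L P (lblocks Z).
Proof. by elim: Z P P' => //= -[[B B'] t] Z IH P P' /=; rewrite IH. Qed.

Lemma rblocks_zsat l r m L P P' Z :
  rblocks (zsat l r m L P P' Z) = sat l r m L P' (rblocks Z).
Proof. by elim: Z P P' => //= -[[B B'] t] Z IH P P' /=; rewrite IH. Qed.

Section Saturated.
Variables (V : monoid_class) (Z : zblocks).
Hypothesis hV : class_incl V (models basis).
Hypothesis VZ : zequal V Z.
Hypothesis sepZ : separated (lblocks Z).
Hypothesis sepZ' : separated (rblocks Z).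
Hypothesis eqZ : letters (lblocks Z) =i letters (rblocks Z).

Let l := `[< holds_in V id_left >].
Let r := `[< holds_in V id_right >].
Let m := `[< holds_in V id_mid >].

(** The lemmas on contents treat a letter missing on the right-hand side; exchanging the sides
    covers the other case. *)
Definition flip (Z : zblocks) : zblocks := [seq (b.1.2, b.1.1, b.2) | b <- Z].

Lemma lblocks_flip Y : lblocks (flip Y) = rblocks Y.
Proof. by rewrite /lblocks /flip -map_comp. Qed.

Lemma rblocks_flip Y : rblocks (flip Y) = lblocks Y.
Proof. by rewrite /rblocks /flip -map_comp. Qed.

(** A difference in content forces an identity on V whose flag already permits the missing
    insertion. This reduces to a propositional check on six occurrence bits and three flags. *)
Lemma saturated_content Z1 Z2 B B' t z : Z = Z1 ++ (B, B', t) :: Z2 ->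
  z \in letters (lblocks Z) ->
  (z \in B) || allowed l r m (z \in letters (lblocks Z1)) (z \in letters (lblocks Z2)) =
  (z \in B') || allowed l r m (z \in letters (rblocks Z1)) (z \in letters (rblocks Z2)).
Proof.
move=> eZ zZ.
have zZ' : z \in letters (rblocks Z) by rewrite -eqZ.
have zE : [|| z \in letters (lblocks Z1), z \in B | z \in letters (lblocks Z2)].
  by have := zZ; rewrite eZ lblocks_cat letters_cat /letters /= !mem_cat.
have zE' : [|| z \in letters (rblocks Z1), z \in B' | z \in letters (rblocks Z2)].
  by have := zZ'; rewrite eZ rblocks_cat letters_cat /letters /= !mem_cat.
have VZf : zequal V (flip Z).
  by move=> M v VM; rewrite lblocks_flip rblocks_flip VZ.
have sepf : separated (lblocks (flip Z)) by rewrite lblocks_flip.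
have eqf : letters (lblocks (flip Z)) =i letters (rblocks (flip Z)).
  by move=> y; rewrite lblocks_flip rblocks_flip eqZ.
have eZf : flip Z = flip Z1 ++ (B', B, t) :: flip Z2.
  by rewrite eZ /flip map_cat.
have zZf : z \in letters (lblocks (flip Z)) by rewrite lblocks_flip.
have lm : l -> m.
  by move=> /asboolP h; apply/asboolP => M VM; apply: left_mid; [exact: hV|exact: h].
have rm : r -> m.
  by move=> /asboolP h; apply/asboolP => M VM; apply: right_mid; [exact: hV|exact: h].
have := asboolT (mid_of hV VZ sepZ eqZ eZ zZ _ _ _ _).
have := asboolT (left_of_first hV VZ sepZ eqZ eZ zZ _ _).
have := asboolT (left_of_last hV VZ sepZ eqZ eZ zZ _ _).
have := asboolT (right_of_first hV VZ sepZ eqZ eZ zZ _ _).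
have := asboolT (right_of_last hV VZ sepZ eqZ eZ zZ _ _).
have := asboolT (mid_of hV VZf sepf eqf eZf zZf _ _ _ _).
have := asboolT (left_of_first hV VZf sepf eqf eZf zZf _ _).
have := asboolT (left_of_last hV VZf sepf eqf eZf zZf _ _).
have := asboolT (right_of_first hV VZf sepf eqf eZf zZf _ _).
have := asboolT (right_of_last hV VZf sepf eqf eZf zZf _ _).
rewrite !lblocks_flip !rblocks_flip -/l -/r -/m.
move: lm rm zE zE'; rewrite /allowed.
case: (z \in B); case: (z \in B'); case: (z \in letters (lblocks Z1));
  case: (z \in letters (rblocks Z1)); case: (z \in letters (lblocks Z2));
  case: (z \in letters (rblocks Z2)); move=> //=;
  case: l; case: r; case: m => //=; intuition.
Qed.

Lemma zsat_wf L Y Z1 : Z = Z1 ++ Y -> L =i letters (lblocks Z) ->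
  forall b, b \in zsat l r m L (letters (lblocks Z1)) (letters (rblocks Z1)) Y ->
  wf_block b.
Proof.
move=> eZ eL; elim: Y Z1 eZ => //= -[[B B'] t] Y IH Z1 eZ b.
rewrite inE => /orP[/eqP ->|]; last first.
  have := IH (rcons Z1 (B, B', t)); rewrite cat_rcons -cats1 lblocks_cat rblocks_cat.
  by rewrite !letters_cat /letters /= !cats0; apply.
split; rewrite /= ?dedup_uniq // => z; rewrite !mem_dedup !mem_cat !mem_filter eL.
have [zZ|zZ] := boolP (z \in letters (lblocks Z)).
  by rewrite !andbT; apply: saturated_content eZ zZ.
rewrite !andbF !orbF.
have : z \notin letters (rblocks Z) by rewrite -eqZ.
move: zZ; rewrite eZ lblocks_cat rblocks_cat !letters_cat /letters /= !mem_cat !negb_or.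
by case/and3P=> _ /negPf-> _ /and3P[_ /negPf-> _].
Qed.

End Saturated.

Section TwoLetters.
Local Open Scope group_scope.
Variable M : monoidType.
Implicit Types v : nat -> M.

Lemma eval_filter v (p : pred nat) w : {in w, forall z, ~~ p z -> v z = 1} ->
  eval_word v w = eval_word v (filter p w).
Proof.
elim: w => //= z w IH h; rewrite eval_cons IH => [|y yw]; last first.
  by apply: h; rewrite inE yw orbT.
by have := h z (mem_head _ _); case: (p z) => [_|->//]; rewrite ?eval_cons ?mul1g.
Qed.

Lemma eval_uniq_pair v s x y : uniq s -> x \in s -> y \in s -> index x s < index y s ->
  {in s, forall z, z != x -> z != y -> v z = 1} -> eval_word v s = v x * v y.
Proof.
move=> us xs ys lt h; move: us ys lt h; case/splitPr: xs => l r.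
rewrite cat_uniq => /and3P[ul /hasPn lr /= /andP[xr ur]].
have xl : x \notin l by apply: lr; rewrite mem_head.
rewrite mem_cat inE !index_cat (negPf xl) /= eqxx addn0.
have [yl|yl] := boolP (y \in l).
  by move=> _ lt; have := index_mem y l; rewrite yl ltnNge (ltnW lt).
have [->|yx] := eqVneq y x; first by rewrite ?eqxx ?addn0 ?ltnn.
move=> /= yr _ h; rewrite eval_cat eval_cons eval_one ?mul1g; last first.
  move=> z zl; apply: h; rewrite ?mem_cat ?zl //; first by apply: contraNneq xl => <-.
  by apply: contraNneq yl => <-.
congr (_ * _); move: yr ur xr h; case/splitPr => r1 r2.
rewrite cat_uniq => /and3P[_ /hasPn h1 /= /andP[h2 _]] xr h.
rewrite eval_cat eval_cons !eval_one ?mulg1 ?mul1g // => z zr.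
  apply: h; first by rewrite !(mem_cat, inE) zr !orbT.
    by apply: contraNneq xr => <-; rewrite mem_cat inE zr !orbT.
  by apply: contraNneq h2 => <-.
apply: h; first by rewrite !(mem_cat, inE) zr !orbT.
  by apply: contraNneq xr => <-; rewrite mem_cat zr.
by have := h1 y (mem_head _ _); apply: contraNneq => <-.
Qed.

Lemma eval_letter (a : M) z w :
  eval_word (fun y => if y == z then a else 1) w = a ^+ count_mem z w.
Proof.
elim: w => [|y w IH]; first by rewrite eval_nil expg0.
by rewrite eval_cons IH /=; case: eqP => _; rewrite ?mul1g ?expgS.
Qed.

Lemma expg_sq (a : M) n : models basis M -> 1 < n -> a ^+ n = sq a.
Proof.
move=> hM; case: n => [|[|n]] // _; elim: n => [|n IH]; first by rewrite expgS expg1 sqE.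
rewrite expgS IH; have := dup_first hM a 1; rewrite !mulg1.
by rewrite -{1}sqE => {2}->; rewrite !sqE mulgA.
Qed.

Lemma eval_comm v L w : (forall a b : M, a * b = b * a) -> uniq L -> {subset w <= L} ->
  eval_word v w = eval_word (fun z => v z ^+ count_mem z w) L.
Proof.
move=> cM uL; elim: w => [|z w IH] sub.
  by rewrite eval_nil eval_one // => y _; rewrite expg0.
rewrite eval_cons IH => [|y yw]; last by apply: sub; rewrite inE yw orbT.
have zL : z \in L by apply: sub; rewrite mem_head.
move: uL {IH sub}; case/splitPr: zL => L1 L2; rewrite cat_uniq => /and3P[_ /hasPn h1 /= /andP[h2 _]].
rewrite !eval_cat !eval_cons /= eqxx add1n expgS mulgA (cM (v z)) -!mulgA.
have E (s : seq nat) : z \notin s -> eval_word (fun y => v y ^+ count_mem y w) s =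
    eval_word (fun y => v y ^+ ((z == y) + count_mem y w)) s.
  by move=> zs; apply: eq_in_eval => y ys; case: eqP => // zy; rewrite zy ys in zs.
by rewrite !E //; apply: h1; rewrite mem_head.
Qed.

End TwoLetters.

Lemma eq_or_inverted s s' : uniq s -> uniq s' -> s =i s' ->
  s = s' \/ exists x y, inverted x y s s'.
Proof.
elim: s' s => [|b s' IH] s us us' e.
  by left; case: s e {us} => // z s /(_ z); rewrite mem_head.
case: s us e => [|a s] us e; first by have := e b; rewrite mem_head.
have [eab|ab] := eqVneq a b; last first.
  right; exists a, b; rewrite /inverted mem_head e mem_head /= !eqxx.
  by rewrite (eq_sym b) (negPf ab).
move: us us' e; rewrite eab /= => /andP[bs us] /andP[bs' us'] e.
have e' : s =i s'.
  move=> z; have := e z; rewrite !inE; have [->|//] := eqVneq z b.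
  by rewrite (negPf bs) (negPf bs').
have [->|[x [y /and4P[xs ys lt lt']]]] := IH s us us' e'; first by left.
right; exists x, y; rewrite /inverted !inE xs ys !orbT /=.
have -> : b == x = false by apply: contraNF bs => /eqP->.
have -> : b == y = false by apply: contraNF bs => /eqP->.
by rewrite !ltnS lt.
Qed.

Lemma fresh (s : seq nat) : exists N, N \notin s.
Proof.
exists (sumn s).+1; apply/negP => h; suff: (sumn s).+1 <= sumn s by rewrite ltnn.
move: (sumn s).+1 h => n; elim: s => //= z s IH; rewrite inE => /orP[/eqP->|/IH h].
  exact: leq_addr.
exact: leq_trans h (leq_addl _ _).
Qed.

Definition critical : seq identity :=
  [:: id_triv; id_idem; id_comm; id_left; id_right; id_mid; id_swap2].

Theorem critical_transfer (V : monoid_class) (M : monoidType) u w :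
  class_incl V (models basis) -> models basis M ->
  (forall e, e \in critical -> holds_in V e -> satisfies M e) ->
  (forall k, holds_in V (id_alt k) -> satisfies M (id_alt k)) ->
  holds_in V (u, w) -> satisfies M (u, w).
Proof.
move=> hV hM Mc Malt Vuw v /=.
have [Vtriv|ntriv] := pselect (holds_in V id_triv).
  by have /satisfies_triv h := Mc id_triv isT Vtriv; rewrite [LHS]h [RHS]h.
have euw : u =i w.
  have sub u' w' : holds_in V (u', w') -> {subset u' <= w'}.
    move=> h z zu; apply: contrapT => /negP zw; apply: ntriv => N VN.
    have hN := hV _ VN; apply/satisfies_triv => a.
    have := h N VN (fun y => if y == z then a else 1%g); rewrite /= !eval_letter.
    rewrite (count_memPn zw) expg0.
    have : 0 < count_mem z u' by rewrite -has_count has_pred1.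
    rewrite leq_eqVlt => /orP[/eqP<-|c]; first by rewrite expg1.
    (* Now a^2 = 1, and a^3 = a^2 gives a = 1. *)
    rewrite expg_sq // => e; have := expg_sq a hN (isT : 1 < 3).
    by rewrite expgS expg_sq // e mulg1.
  have Vwu : holds_in V (w, u) by move=> N VN v'; rewrite /= (Vuw N VN v').
  by move=> z; apply/idP/idP; apply: sub.
(* N closes the last block; [v'] gives it the value 1. *)
have [N] := fresh (u ++ w); rewrite mem_cat negb_or => /andP[Nu Nw].
pose v' z := if z == N then 1%g else v z.
have v'N : v' N = 1%g by rewrite /v' eqxx.
have v'E s : N \notin s -> eval_word v s = eval_word v' s.
  by move=> Ns; apply: eq_in_eval => z zs; rewrite /v'; case: eqP => // zN;
    rewrite -zN zs in Ns.
rewrite !v'E //.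
have Mswap := Mc id_swap2 isT.
(* With idempotency every letter is a square, and a word is a single block. *)
have [Videm|nidem] := pselect (holds_in V id_idem).
  have idem_eval (N' : monoidType) (x : nat -> N') s : models basis N' ->
      satisfies N' id_idem -> sqs x (dedup s) = eval_word x s.
    move=> hN /satisfies_idem h; rewrite sqs_dedup //.
    by apply: eq_in_eval => z _; rewrite sqE h.
  pose Z : zblocks := [:: (dedup u, dedup w, N)].
  have := @zequal_transfer V M Z hV hM Malt Mswap _ _ _ v'.
  rewrite /= v'N !mulg1 !idem_eval //; try exact: Mc Videm.
  apply.
  - move=> b; rewrite inE => /eqP->; split; rewrite /= ?dedup_uniq // => z.
    by rewrite !mem_dedup.
  - rewrite /separated /= /letters /= cats0; apply/hasPn => z.
    by rewrite mem_dedup !inE => zu; apply: contraNneq Nu => <-.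
  - move=> N' x VN; have hN := hV _ VN.
    by rewrite /= !mulg1 !idem_eval //; [congr (_ * _)%g; exact: Vuw|exact: Videm|exact: Videm].
(* A letter occurring once on one side only would give a = a^2 when the others are sent to 1. *)
have ecount z : (count_mem z u == 1) = (count_mem z w == 1).
  have one u' w' : holds_in V (u', w') -> u' =i w' -> count_mem z u' == 1 ->
      count_mem z w' == 1.
    move=> h e c; apply: contrapT => /negP c'; apply: nidem => N' VN.
    apply/satisfies_idem => a; have hN := hV _ VN.
    have := h N' VN (fun y => if y == z then a else 1%g); rewrite /= !eval_letter.
    rewrite (eqP c) expg1 expg_sq ?sqE // ltn_neqAle eq_sym c' /=.
    by rewrite -has_count has_pred1 -e -has_pred1 has_count (eqP c).
  have Vwu : holds_in V (w, u) by move=> N' VN x; rewrite /= (Vuw N' VN x).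
  by apply/idP/idP; apply: one.
(* Under commutativity it only matters whether a letter occurs never, once or more often. *)
have [Vcomm|ncomm] := pselect (holds_in V id_comm).
  have /satisfies_comm cM := Mc id_comm isT Vcomm.
  rewrite !(@eval_comm _ v' (undup u)) ?undup_uniq // => [|z|z]; last 2 first.
  - by rewrite mem_undup euw.
  - by rewrite mem_undup.
  apply: eq_in_eval => z; rewrite mem_undup => zu.
  have cu : 0 < count_mem z u by rewrite -has_count has_pred1.
  have cw : 0 < count_mem z w by rewrite -has_count has_pred1 -euw.
  move: (ecount z); have [->|c1] := eqVneq (count_mem z u) 1.
    by move=> /esym/eqP->.
  move=> /esym/negbT c2; rewrite !expg_sq // ltn_neqAle eq_sym; first by rewrite c2.
  by rewrite c1.
pose ns z := (count_mem z u != 1) && (z != N).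
have nsN : ~~ ns N by rewrite /ns eqxx andbF.
have ecw z : (count_mem z w != 1) = (count_mem z u != 1) by rewrite ecount.
have simpleP z (s : seq nat) : N \notin s -> z \in s -> ~~ ns z -> count_mem z u == 1.
  move=> Ns zs; rewrite /ns negb_and !negbK => /orP[//|/eqP zN].
  by rewrite -zN zs in Ns.
have uniq_simple s : (forall z, (count_mem z s == 1) = (count_mem z u == 1)) ->
    N \notin s -> uniq (filter (predC ns) s).
  move=> e Ns; apply: count_mem_uniq => z.
  have [zs|/count_memPn->//] := boolP (z \in filter (predC ns) s).
  move: zs; rewrite count_filter mem_filter /= => /andP[nz zs].
  have := simpleP z s Ns zs nz; rewrite -e => /eqP <-.
  by apply: eq_count => y /=; case: eqP => // ->; rewrite nz.
pose tu := filter (predC ns) u; pose tw := filter (predC ns) w.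
have utu : uniq tu by apply: uniq_simple.
have utw : uniq tw by apply: uniq_simple => // z; rewrite ecount.
have etuw : tu =i tw by move=> z; rewrite !mem_filter euw.
(* Two linear letters in opposite orders would make V commutative. *)
have etick : tu = tw.
  case: (eq_or_inverted utu utw etuw) => // -[x [y /and4P[xs ys lt lt']]].
  case: ncomm => N' VN; apply/satisfies_comm => a b; have hN := hV _ VN.
  have xy : x != y by apply: contraTneq lt => ->; rewrite ltnn.
  pose val z := if z == x then a else if z == y then b else 1%g.
  have vx : val x = a by rewrite /val eqxx.
  have vy : val y = b by rewrite /val eq_sym (negPf xy) eqxx.
  have v1 z : z != x -> z != y -> val z = 1%g by rewrite /val => /negPf-> /negPf->.
  have nsx : ~~ ns x by move: xs; rewrite mem_filter => /andP[].
  have nsy : ~~ ns y by move: ys; rewrite mem_filter => /andP[].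
  have vf s : eval_word val s = eval_word val (filter (predC ns) s).
    apply: eval_filter => z _; rewrite /= negbK => nz.
    by apply: v1; [apply: contraNneq nsx|apply: contraNneq nsy] => <-.
  have := Vuw N' VN val; rewrite /= (vf u) (vf w) -/tu -/tw.
  rewrite (@eval_uniq_pair _ val tu x y) // => [|z _]; last exact: v1.
  rewrite (@eval_uniq_pair _ val tw y x) -?etuw ?vx ?vy // => z _ zy zx.
  exact: v1.
pose S := parse ns [::] (rcons u N); pose S' := parse ns [::] (rcons w N).
have tS : unzip2 S = rcons tu N by rewrite ticks_parse filter_rcons /= nsN.
have tS' : unzip2 S' = rcons tu N by rewrite ticks_parse filter_rcons /= nsN etick.
have lS : letters S = filter ns u by rewrite letters_parse.
have lS' : letters S' = filter ns w by rewrite letters_parse.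
have sep R s : unzip2 R = rcons tu N -> letters R = filter ns s -> separated R.
  move=> eR lR; rewrite /separated eR lR rcons_uniq utu andbT mem_filter negb_and Nu orbT.
  apply/hasPn => z; rewrite mem_filter => /andP[nz _].
  rewrite /= mem_rcons inE mem_filter /= nz /= orbF.
  by apply: contraTneq nz => ->.
pose Z := zip_blocks S S'.
have eSS : unzip2 S = unzip2 S' by rewrite tS tS'.
have lZ : lblocks Z = S by apply: lblocks_zip.
have rZ : rblocks Z = S' by apply: rblocks_zip.
have evS (N' : monoidType) (x : nat -> N') : models basis N' ->
    evalS x S = (eval_word x u * x N)%g /\ evalS x S' = (eval_word x w * x N)%g.
  move=> hN; have cnt s z : (count_mem z s != 1) = (count_mem z u != 1) -> z \in s ->
      ns z -> 1 < count_mem z s.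
    move=> e zs /andP[]; rewrite -e => c1 _.
    by rewrite ltn_neqAle eq_sym c1 -has_count has_pred1.
  rewrite !evalS_parse // /sqs !eval_nil !mul1g -!eval_square_on // => z zs nz.
    exact: cnt.
  exact: cnt.
have VZ : zequal V Z.
  move=> N' x VN; rewrite lZ rZ; have [-> ->] := evS N' x (hV _ VN).
  by congr (_ * _)%g; apply: Vuw.
have sepZ : separated (lblocks Z) by rewrite lZ; apply: sep tS lS.
have sepZ' : separated (rblocks Z) by rewrite rZ; apply: sep tS' lS'.
have eqZ : letters (lblocks Z) =i letters (rblocks Z).
  by move=> z; rewrite lZ rZ lS lS' !mem_filter euw.
pose l := `[< holds_in V id_left >]; pose r := `[< holds_in V id_right >].
pose m := `[< holds_in V id_mid >]; pose L := letters (lblocks Z).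
pose Zs := zsat l r m L [::] [::] Z.
(* Saturation uses the flags of V, and preserves values both in V and in M because M inherits the
   corresponding identities. *)
have satE (N' : monoidType) (x : nat -> N') : models basis N' ->
    (forall e, e \in critical -> holds_in V e -> satisfies N' e) ->
    evalS x (lblocks Zs) = evalS x S /\ evalS x (rblocks Zs) = evalS x S'.
  move=> hN Nc; rewrite lblocks_zsat rblocks_zsat lZ rZ.
  have hl : l -> satisfies N' id_left by move=> /asboolP; apply: Nc.
  have hr : r -> satisfies N' id_right by move=> /asboolP; apply: Nc.
  have hm : m -> satisfies N' id_mid by move=> /asboolP; apply: Nc.
  by split; [have := @evalS_sat _ hN l r m hl hr hm x L S [::] 1%g|
    have := @evalS_sat _ hN l r m hl hr hm x L S' [::] 1%g];
    rewrite !mul1g => ->.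
have := @zequal_transfer V M Zs hV hM Malt Mswap _ _ _ v'.
have [-> ->] := satE M v' hM Mc.
have [-> ->] := evS M v' hM; rewrite v'N !mulg1; apply.
- exact: (zsat_wf hV VZ sepZ sepZ' eqZ (Z1 := [::])).
- move: sepZ; rewrite /separated lblocks_zsat ticks_sat => /andP[-> /hasPn h] /=.
  by apply/hasPn => z /(letters_sat (fun _ => id)); apply: h.
- move=> N' x VN; have hN := hV _ VN.
  have Nc e : e \in critical -> holds_in V e -> satisfies N' e by move=> _; apply.
  have [-> ->] := satE N' x hN Nc.
  by have := VZ N' x VN; rewrite lZ rZ.
Qed.

(** * Quotients of the free monoid *)

(** The relation may be an arbitrary proposition, such as validity in a class of monoids; the
    quotient makes it boolean classically. *)
Record word_congruence := WordCongruence {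
  congr_rel : word -> word -> Prop;
  congr_refl : forall u, congr_rel u u;
  congr_sym : forall u w, congr_rel u w -> congr_rel w u;
  congr_trans : forall u w s, congr_rel u w -> congr_rel w s -> congr_rel u s;
  congr_cat : forall u u' w w', congr_rel u u' -> congr_rel w w' ->
    congr_rel (u ++ w) (u' ++ w')
}.

Section WordQuotient.
Local Open Scope quotient_scope.
Variable C : word_congruence.

Definition congr_bool (u w : word) : bool := `[< congr_rel C u w >].

Lemma congr_bool_equiv : equiv_class_of congr_bool.
Proof.
split=> [u|u w|w u s]; first exact/asboolP/congr_refl.
  by apply/asboolP/asboolP; apply: congr_sym.
move=> /asboolP uw /asboolP ws; apply/asboolP; exact: congr_trans uw ws.
Qed.

Canonical congr_equiv : equiv_rel word := EquivRelPack congr_bool_equiv.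

Definition word_quotient := {eq_quot congr_equiv}.
HB.instance Definition _ := Choice.on word_quotient.
HB.instance Definition _ := Quotient.on word_quotient.

Lemma word_piP (u w : word) :
  \pi_word_quotient u = \pi_word_quotient w <-> congr_rel C u w.
Proof. by split=> [/eqquotP/asboolP|h] //; apply/eqquotP/asboolP. Qed.

Definition quotient_mul (p q : word_quotient) : word_quotient :=
  \pi_word_quotient (repr p ++ repr q).

Lemma quotient_mulE u w :
  quotient_mul (\pi_word_quotient u) (\pi_word_quotient w) = \pi_word_quotient (u ++ w).
Proof. by apply/word_piP/congr_cat; apply/word_piP; rewrite reprK. Qed.

Lemma quotient_mulA : associative quotient_mul.
Proof.
elim/quotW=> p; elim/quotW=> q; elim/quotW=> s.
by rewrite (quotient_mulE q s) (quotient_mulE p q) !quotient_mulE catA.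
Qed.

Lemma quotient_1mul : left_id (\pi_word_quotient [::]) quotient_mul.
Proof. by elim/quotW=> p; rewrite quotient_mulE. Qed.

Lemma quotient_mul1 : right_id (\pi_word_quotient [::]) quotient_mul.
Proof. by elim/quotW=> p; rewrite quotient_mulE cats0. Qed.

HB.instance Definition _ :=
  isMonoid.Build word_quotient quotient_mulA quotient_1mul quotient_mul1.

Lemma eval_quotient (s : nat -> word) w :
  eval_word (fun i => \pi_word_quotient (s i)) w = \pi_word_quotient (subst s w).
Proof.
elim: w => [|z w IH]; first by rewrite eval_nil.
by rewrite eval_cons IH; exact: quotient_mulE.
Qed.

Lemma satisfies_quotient e : satisfies word_quotient e <->
  forall s : nat -> word, congr_rel C (subst s e.1) (subst s e.2).
Proof.
split=> [h s|h v]; first by apply/word_piP; rewrite -!eval_quotient; apply: h.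
have e1 w : eval_word v w = \pi_word_quotient (subst (repr \o v) w).
  by rewrite -eval_quotient; apply: eq_in_eval => z _; rewrite reprK.
by rewrite !e1; apply/word_piP.
Qed.

End WordQuotient.

(** * Strictness of the infinite chain *)

(* An automaton reading alt_word k from the state k+1 to the state 1; the state 0
   is reached from 1 by reading the letter 0 first, and is never left. *)
Definition alt_step (i c : nat) : option nat :=
  match i with
  | 0 => if c < 2 then Some 0 else None
  | 1 => if c == 0 then Some 0 else None
  | r.+2 => if c == odd r.+1 then Some i else if c == r.+2 then Some r.+1 else None
  end.

Definition run (o : option nat) (w : word) : option nat :=
  foldl (fun o c => obind (fun i => alt_step i c) o) o w.

Lemma run_cat o u w : run o (u ++ w) = run (run o u) w.
Proof. exact: foldl_cat. Qed.

Lemma run_none w : run None w = None.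
Proof. by elim: w. Qed.

Lemma alt_step_le i c j : alt_step i c = Some j -> j <= i.
Proof.
case: i => [|[|r]] /=.
- by case: ifP => // _ [<-].
- by case: ifP => // _ [<-].
- by case: ifP => [_ [<-]|_] //; case: ifP => // _ [<-].
Qed.

Lemma run_cons i c w j : run (Some i) (c :: w) = Some j ->
  exists2 i', alt_step i c = Some i' & run (Some i') w = Some j.
Proof. by rewrite /run /=; case: (alt_step i c) => [i'|]; [exists i'|rewrite -/(run _ _) run_none]. Qed.

Lemma run_le i w j : run (Some i) w = Some j -> j <= i.
Proof.
elim: w i => [|c w IH] i; first by case=> ->.
by case/run_cons => i' /alt_step_le le /IH le'; apply: leq_trans le' le.
Qed.

Definition binary (w : word) := all (fun c => c < 2) w.

(** A separator c is read only in the state c, and leads to a smaller one; states never increase. *)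
Lemma run_tick i w j c : run (Some i) w = Some j -> c \in w -> 1 < c -> j < c <= i.
Proof.
elim: w i => // d w IH i /run_cons[i' e r]; rewrite inE => /orP[/eqP cd|cw] c1; last first.
  by have /andP[-> le] := IH i' r cw c1; rewrite (leq_trans le) // (alt_step_le e).
move: e; rewrite -cd; case: i {IH} => [|[|q]] /=.
- by rewrite ltnNge c1.
- by case: eqP c1 => // ->.
- case: eqP c1 => [->|_ _]; first by case: (odd q).
  by case: eqP => // -> [e]; move: r; rewrite -e => /run_le; rewrite ltnS => ->; rewrite leqnn.
Qed.

(** Hence a letter occurring twice may be assumed to have a binary value: otherwise the run is
    undefined. *)
Lemma run_twice o X T : ~~ binary X -> run (run (run o X) T) X = None.
Proof.
case/allPn => c cX; rewrite -leqNgt => c1.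
case: o => [i|]; last by rewrite !run_none.
case e1: (run (Some i) X) => [j|]; last by rewrite !run_none.
case e2: (run (Some j) T) => [j'|]; last by rewrite !run_none.
case e3: (run (Some j') X) => [j''|] //.
have /andP[h _] := run_tick e1 cX c1; have /andP[_ h'] := run_tick e3 cX c1.
by have := leq_ltn_trans (leq_trans h' (run_le e2)) h; rewrite ltnn.
Qed.

Lemma run0 X : binary X -> run (Some 0) X = Some 0.
Proof. by elim: X => //= c X IH /andP[c2 /IH]; rewrite /run /= c2. Qed.

Lemma run1 c X : binary (c :: X) ->
  run (Some 1) (c :: X) = if c == 0 then Some 0 else None.
Proof.
move=> /andP[_ bX]; rewrite /run /=; case: ifP => _; first exact: run0.
exact: run_none.
Qed.

Lemma run2 r X : binary X ->
  run (Some r.+2) X = if all (pred1 (odd r.+1 : nat)) X then Some r.+2 else None.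
Proof.
elim: X => // c X IH /andP[c2 bX]; rewrite /run [foldl _ _ _]/=.
have [->|ne] /= := eqVneq c (~~ odd r : nat); first by rewrite eqxx -/(run _ _) IH.
by rewrite (negPf ne) (ltn_eqF (leq_trans c2 _)) // -/(run _ _) run_none.
Qed.

Lemma run_absorb o X Y : binary X -> binary Y ->
  run (run (run o X) Y) X = run (run o X) Y.
Proof.
move=> bX bY; case: o => [[|[|r]]|]; last by rewrite !run_none.
- by rewrite !run0.
- case: X bX => // c X bX; rewrite run1 //; case: ifP => _; last by rewrite !run_none.
  by rewrite !run0.
rewrite run2 //; case: ifP => aX; last by rewrite !run_none.
by rewrite run2 //; case: ifP => aY; rewrite ?run_none // run2 // aX.
Qed.

Lemma run_idem o X : binary X -> run (run o X) X = run o X.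
Proof. by move=> bX; have := @run_absorb o X [::] bX isT. Qed.

(** Only the state 1 sees the order of two binary words, through their first letters. Elsewhere a
    binary word either leaves the state unchanged or cannot be read. *)
Lemma run_comm i X Y : binary X -> binary Y ->
  (i = 1 -> X = [::] \/ Y = [::] \/ head 0 X = head 0 Y) ->
  run (run (Some i) X) Y = run (run (Some i) Y) X.
Proof.
move=> bX bY; case: i => [|[|r]] h; first by rewrite !run0.
  case: (h erefl) => [->//|[->//|]]; case: X bX {h} => // c X bX; case: Y bY => // d Y bY cd; rewrite /= in cd.
  by rewrite cd in bX *; rewrite !run1 //; case: ifP => _; rewrite ?run0 // !run_none.
rewrite !run2 //; case: ifP => aX; case: ifP => aY; rewrite ?run_none ?run2 // ?aX ?aY //.
Qed.

(** As the state 0 is avoided, a nonempty binary value is read in states whose parity is given by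
    its first letter. Successive squares have different first letters, so the state drops between
    them. *)
Lemma run_alt_word s k i j : binary (s 0) -> binary (s 1) ->
  s 0 != [::] -> s 1 != [::] -> head 0 (s 0) != head 0 (s 1) ->
  run (Some i) (subst s (alt_word k)) = Some j -> 0 < j ->
  k < i /\ (0 < k -> head 0 (s (odd k)) = odd i.-1).
Proof.
move=> b0 b1 n0 n1 h01; elim: k i => [|k IH] i; first by move=> /run_le le j0; rewrite (leq_trans j0 le).
have bz : binary (s (odd k.+1)) by case: (odd k.+1).
have nz : s (odd k.+1) != [::] by case: (odd k.+1).
have -> : subst s (alt_word k.+1) = s (odd k.+1) ++ s (odd k.+1) ++ s k.+2 ++ subst s (alt_word k) by [].
rewrite !run_cat run_idem // => r j0.
case e1: (run (Some i) (s (odd k.+1))) r => [i1|]; last by rewrite !run_none.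
case e2: (run (Some i1) (s k.+2)) => [i2|]; last by rewrite !run_none.
move=> r; have [ki2 hd] := IH i2 r j0.
have i10 : 0 < i1 by apply: leq_trans (run_le e2); apply: leq_ltn_trans ki2.
case: i e1 => [|[|q]]; first by rewrite run0 // => -[e]; rewrite -e in i10.
  case ez: (s (odd k.+1)) nz bz => [|c X] // _ bz; rewrite run1 //.
  by case: ifP => // _ [e]; rewrite -e in i10.
rewrite run2 //; case: ifP => // aX [e]; have le : i2 <= q.+2 by rewrite e; apply: run_le e2.
have hz : head 0 (s (odd k.+1)) = odd q.+1.
  by case: (s (odd k.+1)) nz aX => // c X _ /= /andP[/eqP].
split=> //; case: k IH ki2 hd hz {bz nz aX r e2} => // k _ ki2 /(_ isT) hd hz.
have ne : i2 != q.+2.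
  apply: contraNneq h01 => ei2; rewrite ei2 /= in hd; rewrite /= in hz.
  move: hd hz; case: (odd k) => /= -> ->; by rewrite eqxx.
have lt : i2 < q.+2 by rewrite ltn_neqAle ne.
exact: leq_ltn_trans ki2 lt.
Qed.

Section AltMonoid.
Variable n : nat.

(** For n > 0, the state n suffices to read [alt_word n.-1] and end in the state 1, where the order
    of two squares shows. *)
Definition alt_rel (u w : word) := forall i, i <= n -> run (Some i) u = run (Some i) w.

Lemma alt_rel_cat u u' w w' : alt_rel u u' -> alt_rel w w' -> alt_rel (u ++ w) (u' ++ w').
Proof.
move=> h h' i ile; rewrite !run_cat h //.
case e: (run (Some i) u') => [j|]; last by rewrite !run_none.
by apply: h'; apply: leq_trans (run_le e) ile.
Qed.

Definition alt_congruence : word_congruence.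
Proof.
apply: (@WordCongruence alt_rel) => //.
- by move=> u w h i /h.
- by move=> u w s h h' i ile; rewrite h // h'.
- exact: alt_rel_cat.
Defined.

Definition alt_monoid : monoidType := word_quotient alt_congruence.

End AltMonoid.

Lemma alt_monoid_basis n : models basis (alt_monoid n).
Proof.
move=> e; rewrite !inE => /or3P[] /eqP->; apply/satisfies_quotient => s i _;
  rewrite /subst /= !cats0 !run_cat.
- have [b|b] := boolP (binary (s 0)); first by rewrite run_idem.
  rewrite run_twice //.
  have := @run_twice (Some i) (s 0) [::] b => /= ->; by rewrite !run_none.
- have [b|b] := boolP (binary (s 0)); first by rewrite run_idem.
  by rewrite run_twice // run_none.
have [b|b] := boolP (binary (s 0)); last first.
  have := @run_twice (Some i) (s 0) [::] b => /= ->; by rewrite !run_none.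
have [b'|b'] := boolP (binary (s 1)); last first.
  have := @run_twice (run (run (Some i) (s 0)) (s 0)) (s 1) [::] b' => /= ->.
  by rewrite !run_none.
by rewrite !run_idem // run_absorb.
Qed.

(** The order of the last two squares could only be seen in the state 1, and by [run_alt_word]
    reaching it requires a start above k + 1. *)
Lemma alt_monoid_succ k : satisfies (alt_monoid k.+1) (id_alt k.+1).
Proof.
apply/satisfies_quotient => s i ile.
suff: run (Some i) (subst s (alt_word k.+1 ++ [:: 0; 0; 1; 1])) =
      run (Some i) (subst s (alt_word k.+1 ++ [:: 1; 1; 0; 0])) by [].
have sc a b : subst s (a ++ b) = subst s a ++ subst s b.
  by rewrite /subst map_cat flatten_cat.
rewrite !sc run_cat [in RHS]run_cat.
case e: (run (Some i) (subst s (alt_word k.+1))) => [j|]; last by rewrite !run_none.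
rewrite /subst /= !cats0 !run_cat.
have [b0|b0] := boolP (binary (s 0)); last first.
  have h o : run (run o (s 0)) (s 0) = None by apply: (@run_twice o (s 0) [::]).
  by rewrite !h !run_none.
have [b1|b1] := boolP (binary (s 1)); last first.
  have h o : run (run o (s 1)) (s 1) = None by apply: (@run_twice o (s 1) [::]).
  by rewrite !h !run_none.
rewrite !run_idem //; apply: run_comm => // j1; rewrite j1 in e.
have [->|n0] := eqVneq (s 0) [::]; first by left.
have [->|n1] := eqVneq (s 1) [::]; first by right; left.
have [->|h01] := eqVneq (head 0 (s 0)) (head 0 (s 1)); first by right; right.
have [] := run_alt_word b0 b1 n0 n1 h01 e isT.
by rewrite ltnNge ile.
Qed.

Lemma run_alt k : run (Some k.+1) (alt_word k) = Some 1.
Proof.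
elim: k => // k IH.
have st : alt_step k.+2 (odd k.+1) = Some k.+2 by rewrite /= eqxx.
have st' : alt_step k.+2 k.+2 = Some k.+1.
  by rewrite /= eqxx; case: eqP => // e; move: e; case: (odd k).
rewrite -[LHS]/(run (obind (alt_step^~ k.+2) (obind (alt_step^~ (odd k.+1))
  (alt_step k.+2 (odd k.+1)))) (alt_word k)).
by rewrite st [obind _ (Some _)]st [obind _ (Some _)]st' IH.
Qed.

Lemma subst_letters w : subst (fun i => [:: i]) w = w.
Proof. by elim: w => //= z w IH; rewrite /subst /= -/(subst _ _) IH. Qed.

Lemma alt_monoid_pred k : ~ satisfies (alt_monoid k.+1) (id_alt k).
Proof.
move=> /satisfies_quotient /(_ (fun i => [:: i])); rewrite !subst_letters.
by move=> /(_ k.+1 (leqnn _)); rewrite !run_cat run_alt.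
Qed.

(** * Finiteness and relatively free monoids *)

Lemma inj_surj_bij (A B : Type) (f : A -> B) :
  injective f -> (forall b, exists a, f a = b) -> bijective f.
Proof.
move=> fI fS; exists (fun b => sval (cid (fS b))) => [a|b].
  by apply: fI; case: (cid _).
by case: (cid _).
Qed.

(** Elements already reached are skipped along the list by a classical case distinction, which needs
    no decidable equality on A. *)
Lemma finite_of_list (T A : Type) (r : T -> A -> Prop) (s : list T) :
  (forall t a a', r t a -> r t a' -> a = a') ->
  (forall a, exists2 t, List.In t s & r t a) -> finite_type A.
Proof.
move=> rU rS.
suff [n [f [fI fS]]] : exists n (f : 'I_n -> A), injective f /\
    forall t a, List.In t s -> r t a -> exists i, f i = a.
  exists n, f; apply: inj_surj_bij => // a; have [t ts ra] := rS a.
  exact: fS ts ra.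
elim: s {rS} => [|t s [n [f [fI fS]]]].
  exists 0, (fun i : 'I_0 => False_rect A (notF (valP i))).
  by split=> [[]|].
have [[a [ra na]]|no] := pselect (exists a, r t a /\ forall i, f i <> a).
  exists n.+1, (fun i => if unlift ord_max i is Some j then f j else a); split.
    move=> i j; case: unliftP => [i'|] ->; case: unliftP => [j'|] -> //.
    - by move=> /fI->.
    - by move=> /na.
    - by move=> /esym/na.
  move=> t' a' [<- ra'|ts' ra'].
    by exists ord_max; rewrite unlift_none; apply: rU ra ra'.
  have [i <-] := fS t' a' ts' ra'; exists (lift ord_max i); by rewrite liftK.
exists n, f; split=> // t' a [<- ra|]; last exact: fS.
apply: contrapT => n'; apply: no; exists a; split=> // i e; apply: n'.
by exists i.
Qed.

Lemma finite_no_inj (A : Type) : finite_type A -> forall g : nat -> A, injective g -> False.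
Proof.
move=> [n [f [h fK hK]]] g gI.
have inj : injective (fun i : 'I_n.+1 => h (g i)).
  by move=> i j /(can_inj hK) /gI /val_inj.
by have := leq_card _ inj; rewrite !card_ord ltnn.
Qed.

(** The enumeration f is thinned to the indices where a new value appears; the injection g ensures
    that they never end. *)
Lemma countable_infinite (A : Type) (f g : nat -> A) :
  (forall a, exists n, f n = a) -> injective g -> equipotent nat A.
Proof.
move=> fS gI.
pose new n := `[< forall m, m < n -> f m <> f n >].
have later n : exists m, (n <= m) && new m.
  apply: contrapT => no.
  have small_ a : exists2 m, m < n & f m = a.
    have [m] := fS a; elim/ltn_ind: m => m IH e.
    have [mn|nm] := ltnP m n; first by exists m.
    have : ~~ new m by apply/negP => nw; apply: no; exists m; rewrite nm.
    move=> /asboolPn /existsNP[m'] /not_implyP[m'm /contrapT e'].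
    by apply: (IH m' m'm); rewrite e'.
  apply: (@finite_no_inj A _ g gI).
  apply: (@finite_of_list nat A (fun m a => f m = a) (iota 0 n)).
    by move=> t a a' -> ->.
  move=> a; have [m mn e] := small_ a; exists m => //.
  have : m \in iota 0 n by rewrite mem_iota.
  by elim: (iota 0 n) => //= x s IH; rewrite inE => /orP[/eqP->|/IH]; [left|right].
pose next n := ex_minn (later n).
pose e k := iter k (fun n => next n.+1) (next 0).
have nextP k : k <= next k /\ new (next k).
  by rewrite /next; case: ex_minnP => m /andP[].
have next_min k m : k <= m -> new m -> next k <= m.
  by move=> km nm; rewrite /next; case: ex_minnP => q _; apply; rewrite km.
have eE k : e k.+1 = next (e k).+1 by [].
have eS k : e k < e k.+1 by rewrite eE; case: (nextP (e k).+1).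
have en k : new (e k).
  by case: k => [|k]; [case: (nextP 0)|rewrite eE; case: (nextP (e k).+1)].
have emono : {homo e : i j / i < j} by exact: (homo_ltn ltn_trans eS).
exists (f \o e); apply: inj_surj_bij => [i j|a].
  move=> /= fij; have [ij|ji|//] := ltngtP i j.
    by have /asboolP h := en j; case: (h _ (emono _ _ ij)).
  by have /asboolP h := en i; case: (h _ (emono _ _ ji)).
have [n0 e0] := fS a.
have ex : exists m, `[< f m = a >] by exists n0; apply/asboolP.
case: (ex_minnP ex) => m /asboolP fm mmin.
have nm : new m.
  apply/asboolP => m' m'm fm'; have := mmin m'; rewrite leqNgt m'm.
  by move=> h; have : false by apply: h; apply/asboolP; rewrite fm' fm.
suff [k ek] : exists k, e k = m by exists k; rewrite /= ek.
apply: contrapT => nk.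
have lt k : e k < m.
  elim: k => [|k IH]; rewrite ltn_neqAle; apply/andP; split.
  - by apply/eqP => h; apply: nk; exists 0.
  - exact: next_min.
  - by apply/eqP => h; apply: nk; exists k.+1.
  - by rewrite eE next_min.
have ge k : k <= e k by elim: k => // k IH; apply: leq_ltn_trans (eS k).
by have := leq_ltn_trans (ge m) (lt m); rewrite ltnn.
Qed.

Section FreeObject.
Variables (V : monoid_class) (n : nat).

Let low (w : word) : word := filter (fun z => z < n) w.

(** The V-free monoid on n letters is a quotient of the free monoid on all letters, those from n on
    being erased. *)
Definition free_rel (u w : word) : Prop := holds_in V (low u, low w).

Definition free_congruence : word_congruence.
Proof.
apply: (@WordCongruence free_rel) => //.
- by move=> u w h M VM v; rewrite /= (h M VM v).
- by move=> u w s h h' M VM v; rewrite /= (h M VM v) -/((low w, low s).1) (h' M VM v).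
- move=> u u' w w' h h' M VM v; rewrite /= /low !filter_cat !eval_cat.
  by congr (_ * _)%g; [exact: h|exact: h'].
Defined.

Definition free_monoid : monoidType := word_quotient free_congruence.

Lemma low_subst s w : low (subst s w) = subst (low \o s) w.
Proof.
elim: w => // z w IH; rewrite /subst /= -!/(subst _ _) -IH /low filter_cat //.
Qed.

Lemma free_monoid_theory e : holds_in V e -> satisfies free_monoid e.
Proof.
move=> h; apply/satisfies_quotient => s M VM v.
by rewrite /= !low_subst !eval_subst; apply: h.
Qed.

Lemma free_monoid_in : monoid_variety V -> V free_monoid.
Proof. by move=> hV; apply: variety_theory => // e /free_monoid_theory. Qed.

Lemma free_monoid_holds u w : all (fun z => z < n) u -> all (fun z => z < n) w ->
  satisfies free_monoid (u, w) -> holds_in V (u, w).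
Proof.
move=> /all_filterP eu /all_filterP ew /satisfies_quotient /(_ (fun i => [:: i])).
by rewrite !subst_letters /= /free_rel /low eu ew.
Qed.

End FreeObject.

Lemma E_enumP : Finite.axiom [:: E0; Ea; Eac; Eb; Ec].
Proof. by case. Qed.

HB.instance Definition _ := isFinite.Build E E_enumP.

(** A class of words is determined by its term function on E^1 in n variables, and there are
    finitely many such functions. *)
Lemma free_monoid_finite (V : monoid_class) n :
  (forall e, satisfies E1 e -> holds_in V e) -> finite_type (free_monoid V n).
Proof.
move=> hE.
pose T := {ffun {ffun 'I_n -> option E} -> option E}.
pose val (g : {ffun 'I_n -> option E}) (i : nat) : E1 :=
  if insub i is Some j then g j else 1%g.
pose code (w : word) : T := [ffun g => eval_word (val g) (filter (fun z => z < n) w) : option E].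
apply: (@finite_of_list T _
  (fun t a => exists2 w, a = \pi_(word_quotient (free_congruence V n))%qT w & code w = t) (enum T)).
  move=> t a a' [u -> <-] [w -> /esym uw]; apply/word_piP => /=; apply: hE => v /=.
  have := congr1 (fun t : T => t [ffun j : 'I_n => (v j : option E)]) uw; rewrite !ffunE.
  have e s : eval_word (val [ffun j : 'I_n => (v j : option E)]) (filter (fun z => z < n) s) =
      eval_word v (filter (fun z => z < n) s).
    apply: eq_in_eval => z; rewrite mem_filter => /andP[zn _].
    by rewrite /val insubT ffunE.
  by rewrite !e.
move=> a; exists (code (generic_quotient.repr a)); last first.
  by exists (generic_quotient.repr a) => //; rewrite generic_quotient.reprK.
move: (code _) => t; have := mem_enum T t; rewrite inE.
by elim: (enum T) => //= x s IH; rewrite inE => /orP[/eqP->|/IH]; [left|right].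
Qed.

(** * Classification of the subvarieties *)

(** T, SL, LRB are the trivial monoids, the semilattices and the left regular bands; C2 the
    commutative monoids with x^2 = x^3; L, R, M have [id_left], [id_right], [id_mid], and B the
    first two. The digit 0 marks the added axiom [id_alt 0]. *)
Inductive var_index := iT | iSL | iLRB | iC2 | iB | iL0 | iL1 | iR | iM0 | iM1
  | iD of nat | iDX | iE.

Definition axioms (i : var_index) : seq identity :=
  match i with
  | iT => [:: id_triv]
  | iSL => [:: id_idem; id_comm]
  | iLRB => [:: id_idem]
  | iC2 => [:: id_comm]
  | iB => [:: id_left; id_right]
  | iL0 => [:: id_left; id_alt 0]
  | iL1 => [:: id_left]
  | iR => [:: id_right]
  | iM0 => [:: id_mid; id_alt 0]
  | iM1 => [:: id_mid]
  | iD k => [:: id_alt k]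
  | iDX => [:: id_swap2]
  | iE => [::]
  end.

Definition var (i : var_index) : monoid_class := models (basis ++ axioms i).

Lemma var_basis i : class_incl (var i) (models basis).
Proof. by move=> M /models_cat[]. Qed.

Lemma varP i M : var i M <-> models basis M /\ models (axioms i) M.
Proof. exact: models_cat. Qed.

Lemma variety_var i : monoid_variety (var i).
Proof. exact: variety_models. Qed.

Lemma var_axiom i e M : var i M -> e \in axioms i -> satisfies M e.
Proof. by case/varP => _ h /h. Qed.

Lemma variety_eq_var (V : monoid_class) i : monoid_variety V ->
  class_incl V (models basis) -> (forall e, e \in axioms i -> holds_in V e) ->
  (forall M, var i M -> (forall e, e \in critical -> holds_in V e -> satisfies M e) /\
    (forall k, holds_in V (id_alt k) -> satisfies M (id_alt k))) ->
  V = var i.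
Proof.
move=> varV hV Vi h; apply: class_eqP => M; split.
  by move=> VM; apply/varP; split; [exact: hV|move=> e ei; exact: Vi].
move=> iM; have [h1 h2] := h M iM; apply: variety_theory => // -[u w].
by apply: critical_transfer => //; exact: var_basis iM.
Qed.

Lemma alt1_pos (M : monoidType) k : satisfies M (id_alt 1) -> 0 < k ->
  satisfies M (id_alt k).
Proof. by move=> h k0; apply: alt_leq h. Qed.

Lemma alt0_all (M : monoidType) k : satisfies M (id_alt 0) -> satisfies M (id_alt k).
Proof. exact: alt_leq. Qed.

Lemma idem_alt0_comm (M : monoidType) : satisfies M id_idem -> satisfies M (id_alt 0) ->
  satisfies M id_comm.
Proof.
move=> /satisfies_idem h /satisfies_alt h0; apply/satisfies_comm => a b.
by have := h0 a b 1%g I; rewrite !mul1g !sqE !h.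
Qed.

(** The case distinction runs from strong to weak identities: those that fail in V transfer
    vacuously, and those that hold follow from the axioms of the index chosen. *)
Theorem subvariety_classification (V : monoid_class) :
  monoid_variety V -> class_incl V (models basis) -> exists i, V = var i.
Proof.
move=> vV hV.
have ax i e M : var i M -> e \in axioms i -> satisfies M e := @var_axiom i e M.
have impl e1 e2 : (forall M, models basis M -> satisfies M e1 -> satisfies M e2) ->
    holds_in V e1 -> holds_in V e2.
  by move=> h V1 M VM; apply: h; [exact: hV|exact: V1].
have i_lm := impl _ _ left_mid; have i_rm := impl _ _ right_mid.
have i_r0 := impl _ _ right_alt0.
have [Vt|nt] := pselect (holds_in V id_triv).
  exists iT; apply: variety_eq_var => // [e|M iM]; first by rewrite inE => /eqP->.
  by split=> *; apply: triv_all; apply: ax iM _; rewrite inE.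
have [Vi|ni] := pselect (holds_in V id_idem).
  have [Vc|nc] := pselect (holds_in V id_comm).
    exists iSL; apply: variety_eq_var => // [e|M iM].
      by rewrite !inE => /orP[]/eqP->.
    have hM := var_basis iM.
    have Mi : satisfies M id_idem by apply: ax iM _; rewrite !inE eqxx.
    have Mc : satisfies M id_comm by apply: ax iM _; rewrite !inE eqxx orbT.
    have M0 := comm_alt0 hM Mc; have Ml := comm_left hM Mc; have Mr := comm_right hM Mc.
    split=> [e|k _]; last exact: alt0_all.
    rewrite !inE => /or4P[|||/or4P[]] /eqP-> // _; first exact: left_mid.
    exact: (alt_swap2 hM M0).
  exists iLRB; apply: variety_eq_var => // [e|M iM]; first by rewrite inE => /eqP->.
  have hM := var_basis iM.
  have Mi : satisfies M id_idem by apply: ax iM _; rewrite inE.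
  have Ml := idem_left hM Mi; have Mm := left_mid hM Ml; have M1 := mid_alt1 hM Mm.
  have n0 : ~ holds_in V (id_alt 0).
    by move=> h; apply: nc => N VN; apply: idem_alt0_comm; [exact: Vi|exact: h].
  have nr : ~ holds_in V id_right by move=> /i_r0.
  split=> [e|[|k] //]; last by move=> _; apply: alt1_pos.
  rewrite !inE => /or4P[|||/or4P[]] /eqP-> // _; exact: (alt_swap2 hM M1).
have [Vc|nc] := pselect (holds_in V id_comm).
  exists iC2; apply: variety_eq_var => // [e|M iM]; first by rewrite inE => /eqP->.
  have hM := var_basis iM.
  have Mc : satisfies M id_comm by apply: ax iM _; rewrite inE.
  have M0 := comm_alt0 hM Mc; have Ml := comm_left hM Mc; have Mr := comm_right hM Mc.
  split=> [e|k _]; last exact: alt0_all.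
  rewrite !inE => /or4P[|||/or4P[]] /eqP-> // _; first exact: left_mid.
  exact: (alt_swap2 hM M0).
have [Vl|nl] := pselect (holds_in V id_left).
  have [Vr|nr] := pselect (holds_in V id_right).
    exists iB; apply: variety_eq_var => // [e|M iM].
      by rewrite !inE => /orP[]/eqP->.
    have hM := var_basis iM.
    have Ml : satisfies M id_left by apply: ax iM _; rewrite !inE eqxx.
    have Mr : satisfies M id_right by apply: ax iM _; rewrite !inE eqxx orbT.
    have M0 := right_alt0 hM Mr.
    split=> [e|k _]; last exact: alt0_all.
    rewrite !inE => /or4P[|||/or4P[]] /eqP-> // _; first exact: left_mid.
    exact: (alt_swap2 hM M0).
  have [V0|n0] := pselect (holds_in V (id_alt 0)).
    exists iL0; apply: variety_eq_var => // [e|M iM].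
      by rewrite !inE => /orP[]/eqP->.
    have hM := var_basis iM.
    have Ml : satisfies M id_left by apply: ax iM _; rewrite !inE eqxx.
    have M0 : satisfies M (id_alt 0) by apply: ax iM _; rewrite !inE eqxx orbT.
    split=> [e|k _]; last exact: alt0_all.
    rewrite !inE => /or4P[|||/or4P[]] /eqP-> // _; first exact: left_mid.
    exact: (alt_swap2 hM M0).
  exists iL1; apply: variety_eq_var => // [e|M iM]; first by rewrite inE => /eqP->.
  have hM := var_basis iM.
  have Ml : satisfies M id_left by apply: ax iM _; rewrite inE.
  have Mm := left_mid hM Ml; have M1 := mid_alt1 hM Mm.
  split=> [e|[|k] //]; last by move=> _; apply: alt1_pos.
  rewrite !inE => /or4P[|||/or4P[]] /eqP-> // _; exact: (alt_swap2 hM M1).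
have [Vr|nr] := pselect (holds_in V id_right).
  exists iR; apply: variety_eq_var => // [e|M iM]; first by rewrite inE => /eqP->.
  have hM := var_basis iM.
  have Mr : satisfies M id_right by apply: ax iM _; rewrite inE.
  have M0 := right_alt0 hM Mr.
  split=> [e|k _]; last exact: alt0_all.
  rewrite !inE => /or4P[|||/or4P[]] /eqP-> // _; first exact: right_mid.
  exact: (alt_swap2 hM M0).
have [Vm|nm] := pselect (holds_in V id_mid).
  have [V0|n0] := pselect (holds_in V (id_alt 0)).
    exists iM0; apply: variety_eq_var => // [e|M iM].
      by rewrite !inE => /orP[]/eqP->.
    have hM := var_basis iM.
    have Mm : satisfies M id_mid by apply: ax iM _; rewrite !inE eqxx.
    have M0 : satisfies M (id_alt 0) by apply: ax iM _; rewrite !inE eqxx orbT.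
    split=> [e|k _]; last exact: alt0_all.
    rewrite !inE => /or4P[|||/or4P[]] /eqP-> // _; exact: (alt_swap2 hM M0).
  exists iM1; apply: variety_eq_var => // [e|M iM]; first by rewrite inE => /eqP->.
  have hM := var_basis iM.
  have Mm : satisfies M id_mid by apply: ax iM _; rewrite inE.
  have M1 := mid_alt1 hM Mm.
  split=> [e|[|k] //]; last by move=> _; apply: alt1_pos.
  rewrite !inE => /or4P[|||/or4P[]] /eqP-> // _; exact: (alt_swap2 hM M1).
have [ex|nalt] := pselect (exists k, `[< holds_in V (id_alt k) >]).
  case: (ex_minnP ex) => k /asboolP Vk kmin.
  exists (iD k); apply: variety_eq_var => // [e|M iM]; first by rewrite inE => /eqP->.
  have hM := var_basis iM.
  have Mk : satisfies M (id_alt k) by apply: ax iM _; rewrite inE.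
  split=> [e|l Vl]; last by apply: alt_leq Mk; apply/kmin/asboolP.
  rewrite !inE => /or4P[|||/or4P[]] /eqP-> // _; exact: (alt_swap2 hM Mk).
have n_k k : ~ holds_in V (id_alt k) by move=> h; apply: nalt; exists k; apply/asboolP.
have [Vs|ns] := pselect (holds_in V id_swap2).
  exists iDX; apply: variety_eq_var => // [e|M iM]; first by rewrite inE => /eqP->.
  have Ms : satisfies M id_swap2 by apply: ax iM _; rewrite inE.
  split=> [e|k /n_k//].
  by rewrite !inE => /or4P[|||/or4P[]] /eqP->.
exists iE; apply: variety_eq_var => // M iM; split=> [e|k /n_k//].
by rewrite !inE => /or4P[|||/or4P[]] /eqP->.
Qed.

(** * Smallness and finite generation *)

Lemma E1_basis : models basis E1.
Proof.
by apply/satisfies_basis; split; case=> [[]|] [[]|].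
Qed.

Lemma E1_not_swap2 : ~ satisfies E1 id_swap2.
Proof.
move=> /(_ (fun i => match i with 0 => Some Eb | 1 => Some Ec | _ => Some Ea end)).
by rewrite /= !evalE.
Qed.

(** As the weakest critical identity, [id_swap2] refutes all others where it fails. *)
Lemma swap2_of_critical (M : monoidType) e : models basis M -> e \in critical ->
  satisfies M e -> satisfies M id_swap2.
Proof.
move=> hM; rewrite !inE => /or4P[|||/or4P[]] /eqP-> h //.
- exact: triv_all.
- exact/(alt_swap2 hM (k := 1))/mid_alt1/left_mid/idem_left.
- exact/(alt_swap2 hM (k := 0))/comm_alt0.
- exact/(alt_swap2 hM (k := 1))/mid_alt1/left_mid.
- exact/(alt_swap2 hM (k := 0))/right_alt0.
- exact/(alt_swap2 hM (k := 1))/mid_alt1.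
Qed.

(** E^1 fails every critical identity, so nothing has to be checked when transferring from a variety
    that contains it. *)
Lemma variety_E1 : variety_generated_by E1 = var iE.
Proof.
apply: class_eqP => M; split=> [h|hM].
  by apply: (h (var iE)); [exact: variety_var|apply/varP; split=> //; exact: E1_basis].
move=> V [S VS] VE.
(* V is cut down to the models of [basis]; the result is again a variety containing E^1. *)
have : (fun N => V N /\ models basis N) M; last by case.
apply: (@variety_theory (fun N => V N /\ models basis N)).
  exists (fun e => S e \/ e \in basis) => N; split=> [[/VS h1 h2] e [/h1|/h2]//|h].
  by split; [apply/VS => e Se; apply: h; left|move=> e eb; apply: h; right].
have hE : V E1 /\ models basis E1 by split=> //; exact: E1_basis.
have hM' := var_basis hM.
have no e : satisfies E1 e -> (satisfies E1 e -> satisfies E1 id_swap2) -> satisfies M e.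
  by move=> h /(_ h)/E1_not_swap2.
move=> [u w]; apply: critical_transfer => //; first by move=> N [].
  by move=> e ec /(_ E1 hE)/no; apply; apply: swap2_of_critical ec; exact: E1_basis.
by move=> k /(_ E1 hE)/no; apply; apply: alt_swap2; exact: E1_basis.
Qed.

Lemma var_inE i : class_incl (var i) (var iE).
Proof. by move=> M /varP[hM _]; apply/varP. Qed.

Lemma var_le i j : (forall M, models basis M -> models (axioms i) M -> models (axioms j) M) ->
  class_incl (var i) (var j).
Proof. by move=> h M /varP[hM /(h M hM) hj]; apply/varP. Qed.

Section Order.
Variables (M : monoidType).
Hypothesis hM : models basis M.

Lemma axioms_le_alt (i : var_index) : models (axioms i) M ->
  match i with iDX | iE => True | iD k => satisfies M (id_alt k)
  | iT | iSL | iC2 | iB | iL0 | iR | iM0 => satisfies M (id_alt 0)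
  | _ => satisfies M (id_alt 1) end.
Proof.
case: i => //=; rewrite ?models1 ?models2.
- exact: triv_all.
- by case=> _ /(comm_alt0 hM).
- by move=> /(idem_left hM)/(left_mid hM)/(mid_alt1 hM).
- exact: comm_alt0.
- by case=> _ /(right_alt0 hM).
- by case.
- by move=> /(left_mid hM)/(mid_alt1 hM).
- exact: right_alt0.
- by case.
- exact: mid_alt1.
- by move=> k; rewrite models1.
Qed.

End Order.

Lemma var_bounded i : i <> iDX -> i <> iE -> exists k, class_incl (var i) (var (iD k)).
Proof.
move=> nX nE.
suff [k h] : exists k, forall M, models basis M -> models (axioms i) M -> satisfies M (id_alt k).
  by exists k; apply: var_le => M hM hi; apply/models1/h.
exists (match i with iLRB | iL1 | iM1 => 1 | iD k => k | _ => 0 end).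
by move=> M hM /(axioms_le_alt hM); case: (i) nX nE.
Qed.

Lemma var_alt_inj : injective (fun k => var (iD k)).
Proof.
move=> k l; wlog lt : k l / k < l.
  move=> h e; have [lt|lt|//] := ltngtP k l; first exact: h.
  by apply/esym/h.
move=> e; exfalso; apply: (@alt_monoid_pred k).
have : var (iD k) (alt_monoid k.+1).
  have -> : var (iD k) = var (iD l) by [].
  apply/varP; split; first exact: alt_monoid_basis.
  by apply/models1; apply: alt_leq lt _; apply: alt_monoid_succ.
by case/varP => _ /models1.
Qed.

Definition beyond (k : nat) (j : var_index) : bool :=
  match j with iD l => k < l | iDX | iE => true | _ => false end.

Lemma alt_monoid_var k j : beyond k j -> var j (alt_monoid k.+1).
Proof.
have hM := @alt_monoid_basis k.+1; have hk := @alt_monoid_succ k.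
case: j => // [l lt|_]; apply/varP; split=> //.
  by apply/models1; apply: alt_leq lt hk.
by apply/models1; apply: (alt_swap2 hM hk).
Qed.

Definition base_indices : seq var_index :=
  [:: iT; iSL; iLRB; iC2; iB; iL0; iL1; iR; iM0; iM1; iDX; iE].

Definition index_of (n : nat) : var_index :=
  if n < 12 then nth iT base_indices n else iD (n - 12).

Lemma index_of_surj i : exists n, index_of n = i.
Proof.
case: i; [exists 0|exists 1|exists 2|exists 3|exists 4|exists 5|exists 6|exists 7
  |exists 8|exists 9| |exists 10|exists 11] => // k.
by exists (k + 12); rewrite /index_of addnK ltnNge leq_addl.
Qed.

(** A subvariety of [var (iD k)] omits [alt_monoid k.+1]; hence its index is not [beyond k], and
    finitely many indices remain. *)
Lemma var_small i : i <> iDX -> i <> iE -> small (var i).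
Proof.
move=> nX nE; have [k hk] := var_bounded nX nE.
(* The bound counts the twelve base indices and [iD 0], ..., [iD k]. *)
apply: (@finite_of_list nat _ (fun n U => sval U = var (index_of n)) (iota 0 (k + 13))).
  by move=> n [U hU] [U' hU'] /= e e'; apply/eq_exist; rewrite e e'.
move=> [U [vU hU]] /=.
have [j ej] : exists j, U = var j.
  by apply: subvariety_classification => // M /hU; apply: var_basis.
have mem n m : n < m -> List.In n (iota 0 m).
  move=> nm; have : n \in iota 0 m by rewrite mem_iota.
  by elim: (iota 0 m) => //= x s IH; rewrite inE => /orP[/eqP->|/IH]; [left|right].
have no : ~ beyond k j.
  move=> /(@alt_monoid_var k j); rewrite -ej => /hU/hk/varP[_ /models1].
  exact: alt_monoid_pred.
have [n en] := index_of_surj j.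
have [n12|n12] := ltnP n 12.
  exists n; last by rewrite en.
  by apply: mem; apply: leq_trans n12 _; rewrite (leq_trans _ (leq_addl _ _)).
exists n; last by rewrite en.
apply: mem; move: en no; rewrite /index_of ltnNge n12 /= => <- /negP.
by rewrite /= -leqNgt leq_subLR => h; rewrite (addnS k 12) ltnS addnC.
Qed.

Lemma variety_generated_variety M : monoid_variety (variety_generated_by M).
Proof.
exists (fun e => satisfies M e) => N; split=> [h e he|h V [S VS] VM].
  have : models [:: e] N by apply: (h (models [:: e])); [exact: variety_models|exact/models1].
  by move=> /models1.
by apply/VS => e Se; apply: h; apply: (proj1 (VS M) VM).
Qed.

Lemma alt_word_low k : all (fun z => z < k + 3) (alt_word k).
Proof.
elim: k => //= k IH; rewrite addSn; apply/and4P; split.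
- by case: (odd k); rewrite ?addnS.
- by case: (odd k); rewrite ?addnS.
- by rewrite addnS !ltnS !addnS addn0 leqnSn.
- by apply: sub_all IH => z /leq_trans; apply; rewrite leqnSn.
Qed.

(** The variety is generated by its free monoid on enough letters to decide every critical identity
    that may fail. *)
Lemma var_finitely_generated i : i <> iDX -> i <> iE -> finitely_generated (var i).
Proof.
move=> nX nE; have [k hk] := var_bounded nX nE.
have Vk : holds_in (var i) (id_alt k) by move=> M /hk/varP[_ /models1].
have hV := @var_basis i.
(* Three letters are needed for [critical], and [id_alt l] with l < k stays below k + 3; for larger
   l it holds anyway. *)
pose M := free_monoid (var i) (k + 3).
have VM : var i M by apply: free_monoid_in; apply: variety_var.
have hM := var_basis VM.
exists M; split.
  apply: free_monoid_finite => e hE N VN.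
  have : variety_generated_by E1 N by rewrite variety_E1; apply: var_inE VN.
  by move=> /(_ (models [:: e]) (variety_models _)) h; apply/models1/h/models1.
apply: class_eqP => N; split; last by move=> h; apply: (h (var i)) => //; exact: variety_var.
move=> VN; have hU : class_incl (variety_generated_by M) (models basis).
  by move=> P h; apply: (h (models basis)); [exact: variety_models|exact: hM].
have MU : variety_generated_by M M by move=> V _.
apply: variety_theory; first exact: variety_generated_variety.
move=> [u w]; apply: critical_transfer; [exact: hU|exact: hV|move=> e ec|move=> l].
  move=> /(_ M MU) he; suff : holds_in (var i) e by apply.
  have low : all (fun z => z < k + 3) e.1 && all (fun z => z < k + 3) e.2.
    move: ec; rewrite !inE !addnS addn0.
    by move=> /or4P[|||/or4P[]] /eqP->.
  by case: e {ec} he low => u' w' he /andP[]; move=> h1 h2; apply: free_monoid_holds he.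
move=> /(_ M MU) hl.
have [kl|lk] := leqP k l; first by apply: alt_leq kl _; apply: Vk.
suff : holds_in (var i) (id_alt l) by apply.
apply: free_monoid_holds hl; rewrite all_cat /= !addnS /= andbT;
  apply: sub_all (alt_word_low l) => z /leq_trans; apply;
  by rewrite -!addnS leq_add2r ltnW.
Qed.

(** * Order on the subvarieties *)

(** With an identity adjoined, this semigroup and the next two witness the antichain [iLRB], [iL0],
    [iR]. *)
Definition left_zero : Type := bool.
HB.instance Definition _ := Choice.on left_zero.
Definition left_zero_mul (x y : left_zero) : left_zero := x.
Lemma left_zero_mulA : associative left_zero_mul.
Proof. by []. Qed.
HB.instance Definition _ := isSemigroup.Build left_zero left_zero_mulA.

(* The semigroup { b, a, 0 } with b b = b, a b = a and all other products 0,
   encoded with b = Some true, a = Some false and 0 = None; and its dual. *)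
Definition right_unit : Type := option bool.
HB.instance Definition _ := Choice.on right_unit.
Definition right_unit_mul (x y : right_unit) : right_unit :=
  if y is Some true then x else None.
Lemma right_unit_mulA : associative right_unit_mul.
Proof. by case=> [[]|] [[]|] [[]|]. Qed.
HB.instance Definition _ := isSemigroup.Build right_unit right_unit_mulA.

Definition left_unit : Type := option bool.
HB.instance Definition _ := Choice.on left_unit.
Definition left_unit_mul (x y : left_unit) : left_unit :=
  if x is Some true then y else None.
Lemma left_unit_mulA : associative left_unit_mul.
Proof. by case=> [[]|] [[]|] [[]|]. Qed.
HB.instance Definition _ := isSemigroup.Build left_unit left_unit_mulA.

Lemma left_zero_LRB : var iLRB (adjoin_one left_zero).
Proof.
apply/varP; split; first by apply/satisfies_basis; split; case=> [[]|] [[]|].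
by apply/models1/satisfies_idem; case=> [[]|].
Qed.

Lemma left_zero_not_alt0 : ~ satisfies (adjoin_one left_zero) (id_alt 0).
Proof.
move=> /(_ (fun i => if i is 0 then Some true else Some false)).
by rewrite /= !evalE.
Qed.

Lemma right_unit_L0 : var iL0 (adjoin_one right_unit).
Proof.
apply/varP; split; first by apply/satisfies_basis; split; case=> [[[]|]|] [[[]|]|].
apply/models2; split; first by apply/satisfies_left; case=> [[[]|]|] [[[]|]|].
apply/satisfies_alt => a b m _; rewrite !sqE.
by move: a b m; case=> [[[]|]|] [[[]|]|] [[[]|]|].
Qed.

Lemma left_unit_R : var iR (adjoin_one left_unit).
Proof.
apply/varP; split; first by apply/satisfies_basis; split; case=> [[[]|]|] [[[]|]|].
by apply/models1/satisfies_right; case=> [[[]|]|] [[[]|]|].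
Qed.

Lemma var_incomparable i j :
  i \in [:: 0; 1; 2] -> j \in [:: 0; 1; 2] ->
  class_incl (var (nth iT [:: iLRB; iL0; iR] i)) (var (nth iT [:: iLRB; iL0; iR] j)) ->
  i = j.
Proof.
have n1 : ~ satisfies (adjoin_one right_unit) id_idem.
  by move=> /satisfies_idem/(_ (Some (Some false))).
have n2 : ~ satisfies (adjoin_one left_unit) id_idem.
  by move=> /satisfies_idem/(_ (Some (Some false))).
have n3 : ~ satisfies (adjoin_one right_unit) id_right.
  by move=> /satisfies_right/(_ (Some (Some true)) (Some (Some false))).
have n4 : ~ satisfies (adjoin_one left_unit) id_left.
  by move=> /satisfies_left/(_ (Some (Some true)) (Some (Some false))).
rewrite !inE => /or3P[] /eqP-> /or3P[] /eqP-> //= h; exfalso.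
- have /varP[_ /models2[_]] := h _ left_zero_LRB; exact: left_zero_not_alt0.
- have /varP[hM /models1] := h _ left_zero_LRB.
  by move=> /(right_alt0 hM); exact: left_zero_not_alt0.
- by have /varP[_ /models1] := h _ right_unit_L0.
- by have /varP[_ /models1] := h _ right_unit_L0.
- by have /varP[_ /models1] := h _ left_unit_R.
- by have /varP[_ /models2[]] := h _ left_unit_R.
Qed.

(** After [iM1] comes [iD 1], because [id_mid] yields [id_alt 1]; [iD 0] is placed at the top of
    [chain1], which stays there from position 4 on. *)
Definition chain0 (n : nat) : var_index :=
  if n < 5 then nth iT [:: iT; iSL; iLRB; iL1; iM1] n else iD (n - 4).

Definition chain1 (n : nat) : var_index := nth (iD 0) [:: iC2; iB; iL0; iM0] n.

Lemma chain0_succ n : class_incl (var (chain0 n)) (var (chain0 n.+1)).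
Proof.
have [n5|n5] := ltnP n 5; last first.
  rewrite /chain0 (ltnNge n) n5 (ltnNge n.+1) (leq_trans n5 (leqnSn n)) /=.
  rewrite subSn; last exact: leq_trans n5.
  by apply: var_le => M hM; rewrite !models1; apply: alt_succ.
case: n n5 => [|[|[|[|[|n]]]]] // _; rewrite /chain0 /=; apply: var_le => M hM;
  rewrite ?models1 ?models2.
- by split; apply: triv_all.
- by case.
- exact: idem_left.
- exact: left_mid.
- exact: mid_alt1.
Qed.

Lemma chain1_succ n : class_incl (var (chain1 n)) (var (chain1 n.+1)).
Proof.
case: n => [|[|[|[|n]]]]; rewrite /chain1 /=; last by rewrite !nth_nil.
all: apply: var_le => M hM; rewrite ?models1 ?models2.
- by split; [apply: comm_left|apply: comm_right].
- by case=> hl /(right_alt0 hM).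
- by case=> /(left_mid hM).
- by case.
Qed.

Lemma chain_leq (c : nat -> var_index) :
  (forall n, class_incl (var (c n)) (var (c n.+1))) ->
  forall n m, n <= m -> class_incl (var (c n)) (var (c m)).
Proof.
move=> h n m /subnK <-; elim: (m - n) => // d IH M /IH; exact: h.
Qed.

(** Three chains cover all indices, which bounds every antichain by three; [iDX] and [iE] sit on top
    of [chain0], and [iR] is alone. *)
Definition chain_of (i : var_index) : 'I_3 :=
  match i with
  | iR => @Ordinal 3 2 isT
  | iC2 | iB | iL0 | iM0 | iD 0 => @Ordinal 3 1 isT
  | _ => @Ordinal 3 0 isT
  end.

Lemma chain_total i j : chain_of i = chain_of j ->
  class_incl (var i) (var j) \/ class_incl (var j) (var i).
Proof.
have chain0P k : chain_of k = @Ordinal 3 0 isT -> [\/ exists n, k = chain0 n, k = iDX | k = iE].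
  case: k => //.
  - by constructor 1; exists 0.
  - by constructor 1; exists 1.
  - by constructor 1; exists 2.
  - by constructor 1; exists 3.
  - by constructor 1; exists 4.
  - case=> // k _; constructor 1; exists (k + 5).
    by rewrite /chain0 ltnNge leq_addl /= -[5]/(1 + 4) addnA addnK addn1.
  - by constructor 2.
  - by constructor 3.
have chain1P k : chain_of k = @Ordinal 3 1 isT -> exists n, k = chain1 n.
  by case: k => // [|||| [|k]] // _; [exists 0|exists 1|exists 2|exists 3|exists 4].
have chain2P k : chain_of k = @Ordinal 3 2 isT -> k = iR by case: k => // -[].
have tot c : (forall n, class_incl (var (c n)) (var (c n.+1))) -> forall n m,
    class_incl (var (c n)) (var (c m)) \/ class_incl (var (c m)) (var (c n)).
  move=> h n m; have [le|/ltnW le] := leqP n m; first by left; apply: chain_leq.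
  by right; apply: chain_leq.
have subX n : class_incl (var (chain0 n)) (var iDX).
  (* From position 5 on every index has the form [iD k], where [alt_swap2] applies. *)
  have le : class_incl (var (chain0 n)) (var (chain0 (n + 5))).
    by apply: (chain_leq chain0_succ); apply: leq_addr.
  move=> M /le; rewrite /chain0 ltnNge leq_addl /=; apply: var_le => N hN.
  by rewrite !models1; apply: alt_swap2.
move e: (chain_of i) => c; case: c e => -[|[|[|c]]] //= lt e;
  rewrite (bool_irrelevance lt isT) in e *.
- move=> /esym/chain0P; case: (chain0P _ e) => [[n ->]|->|->] [[m ->]|->|->].
  + exact: tot chain0_succ n m.
  + by left.
  + by left; apply: var_inE.
  + by right.
  + by left.
  + by left; apply: var_inE.
  + by right; apply: var_inE.
  + by right; apply: var_inE.
  + by left.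
- move=> /esym/chain1P[m ->]; have [n ->] := chain1P _ e.
  exact: tot chain1_succ n m.
- by move=> /esym/chain2P->; rewrite (chain2P _ e); left.
Qed.

(** * Width, Cross property and number of the subvarieties *)

Definition subvar (i : var_index) : subvarieties (var iE) :=
  exist _ (var i) (conj (variety_var i) (@var_inE i)).

Lemma subvar_surj (U : subvarieties (var iE)) : exists i, U = subvar i.
Proof.
case: U => U [vU hU].
have [i e] : exists i, U = var i.
  by apply: subvariety_classification => // M /hU; apply: var_basis.
by exists i; apply: eq_exist.
Qed.

Lemma not_small i : i = iDX \/ i = iE -> ~ small (var i).
Proof.
move=> hi /finite_no_inj h.
have sub k : class_incl (var (iD k)) (var i).
  case: hi => ->; last exact: var_inE.
  by apply: var_le => M hM; rewrite !models1; apply: alt_swap2.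
apply: (h (fun k => exist _ (var (iD k)) (conj (variety_var (iD k)) (@sub k)))).
by move=> k l /(congr1 sval) /=; apply: var_alt_inj.
Qed.

Lemma var_finitely_based i : finitely_based (var i).
Proof. by exists (basis ++ axioms i). Qed.

Lemma Cross_var i : i <> iDX -> i <> iE -> Cross (var i).
Proof.
by split; [exact: var_finitely_based|exact: var_finitely_generated|exact: var_small].
Qed.

Lemma width_subvarieties : has_width (@subvariety_le (var iE)) 3.
Proof.
split.
  have mem (i : 'I_3) : (i : nat) \in [:: 0; 1; 2] by case: i => -[|[|[|]]].
  pose x (i : 'I_3) := subvar (nth iT [:: iLRB; iL0; iR] i).
  have le i j : subvariety_le (x i) (x j) -> i = j.
    by move=> h; apply: val_inj; apply: (var_incomparable (mem i) (mem j) h).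
  by exists x; split=> // i j e; apply: le; rewrite e => M.
move=> m [x [_ xa]].
pose c (i : 'I_m) := sval (cid (subvar_surj (x i))).
have cE i : x i = subvar (c i) by rewrite /c; case: (cid _).
have inj : injective (chain_of \o c).
  move=> i j /chain_total[] h; [|apply: esym]; apply: xa; by rewrite !cE.
by have := leq_card _ inj; rewrite !card_ord.
Qed.

Theorem mainTheorem4 :
  let W := variety_generated_by E1 in
  [/\ equipotent nat (subvarieties W),
      has_width (@subvariety_le W) 3,
      forall V, subvariety W V -> finitely_based V
    & equipotent 'I_2 {V : subvarieties W | ~ Cross (sval V)}].
Proof.
rewrite variety_E1; split.
- apply: (@countable_infinite _ (subvar \o index_of) (subvar \o iD)).
    move=> U; have [i ->] := subvar_surj U; have [n en] := index_of_surj i.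
    by exists n; rewrite /= en.
  by move=> k l /(congr1 sval) /=; apply: var_alt_inj.
- exact: width_subvarieties.
- move=> V hV; have [i e] := subvar_surj (exist _ V hV).
  by have /= -> := congr1 sval e; apply: var_finitely_based.
have nC i : i = iDX \/ i = iE -> ~ Cross (sval (subvar i)).
  by move=> hi [_ _]; apply: not_small.
pose f (i : 'I_2) : {V : subvarieties (var iE) | ~ Cross (sval V)} :=
  if i == ord0 then exist _ (subvar iDX) (nC _ (or_introl erefl))
  else exist _ (subvar iE) (nC _ (or_intror erefl)).
have XE : var iDX <> var iE.
  move=> e; apply: E1_not_swap2.
  have : var iDX E1 by rewrite e; apply/varP; split=> //; exact: E1_basis.
  by case/varP => _ /models1.
exists f; apply: inj_surj_bij.
  move=> i j; rewrite /f; case: eqP => [->|i0]; case: eqP => [->|j0] //.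
  - by move=> /(congr1 (fun U => sval (sval U))).
  - by move=> /(congr1 (fun U => sval (sval U))) /esym.
  by move=> _; apply: val_inj; case: i j i0 j0 => [[|[|i]] ?] [[|[|j]] ?] //= i0 j0;
    try by [case: i0; apply: val_inj|case: j0; apply: val_inj].
move=> [U nU]; have [i e] := subvar_surj U.
have [iX|nX] := pselect (i = iDX).
  by exists ord0; rewrite /f eqxx; apply: eq_exist; rewrite e iX.
have [iE'|nE] := pselect (i = iE).
  by exists ord_max; rewrite /f /=; apply: eq_exist; rewrite e iE'.
by case: nU; rewrite e; apply: Cross_var.
Qed.
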